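(* Let $F$ be a field of characteristic zero and let $\alpha,\beta \in F\setminus\{0\}$ with $\alpha\neq\beta$. As a trace $T$-ideal, $\mathrm{Id}^{tr}(D_2^{t_{\alpha,\beta}})$ is generated by the polynomials $$f_1=[x_1,x_2],$$ $$f_4=-x_1\mathrm{Tr}(x_2)\mathrm{Tr}(x_3)+(\alpha+\beta)x_1\mathrm{Tr}(x_2x_3)+x_3\mathrm{Tr}(x_1)\mathrm{Tr}(x_2)-(\alpha+\beta)x_3\mathrm{Tr}(x_1x_2)-\mathrm{Tr}(x_1)\mathrm{Tr}(x_2x_3)+\mathrm{Tr}(x_3)\mathrm{Tr}(x_1x_2),$$ $$\begin{aligned}f_5={}&\mathrm{Tr}(x_1)\mathrm{Tr}(x_2)\mathrm{Tr}(x_3)-(\alpha\beta^2+\alpha^2\beta)x_1x_2x_3+\alpha\beta x_1x_2\mathrm{Tr}(x_3)+\alpha\beta x_1x_3\mathrm{Tr}(x_2)+\alpha\beta x_2x_3\mathrm{Tr}(x_1)\\&-(\alpha+\beta)x_1\mathrm{Tr}(x_2)\mathrm{Tr}(x_3)+(\alpha^2+\alpha\beta+\beta^2)x_1\mathrm{Tr}(x_2x_3)-\alpha\beta x_2\mathrm{Tr}(x_1x_3)-\alpha\beta x_3\mathrm{Tr}(x_1x_2)\\&+\alpha\beta\,\mathrm{Tr}(x_1x_2x_3)-(\alpha+\beta)\mathrm{Tr}(x_1)\mathrm{Tr}(x_2x_3).\end{aligned}$$ Moreover, $c_n^{tr}(D_2^{t_{\alpha,\beta}})=2^{n+1}-n-1$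 (for every $n\ge 1$).
   Context: $F$ is a field of characteristic 0. An algebra with trace is a unitary associative $F$-algebra $A$ with an $F$-linear map $\mathrm{tr}:A\to F$ such that $\mathrm{tr}(ab)=\mathrm{tr}(ba)$; a scalar $\alpha\in F$ is identified with $\alpha\cdot 1_A$. The free algebra with trace $F\langle X,\mathrm{Tr}\rangle\cong F\langle X\rangle\otimes F[\mathrm{Tr}(M)]$ on $X=\{x_1,x_2,\dots\}$ is generated by the free unitary associative algebra $F\langle X\rangle$ and central commuting indeterminates $\mathrm{Tr}(M)$, $M$ a nonempty word in $X$, subject to $\mathrm{Tr}(MN)=\mathrm{Tr}(NM)$ and $\mathrm{Tr}(\mathrm{Tr}(M)N)=\mathrm{Tr}(M)\mathrm{Tr}(N)$. An element $f$ is a trace identity of $A$ if it becomes $0$ whenever the variables $x_i$ are replaced by arbitrary elements of $A$ and $\mathrm{Tr}$ by $\mathrm{tr}$; $\mathrm{Id}^{tr}(A)$ is the set of trace identities of $A$. A trace $T$-ideal is an ideal of $F\langle X,\mathrm{Tr}\rangle$ invariant under all endomorphisms of the free algebra with trace, i.e. under all substitutions $x_i\mapsto g_i$ (performed also inside $\mathrm{Tr}$), where $g_i$ is a linear combination of products of a (possibly empty) product of traces with a nonempty word. The trace $T$-ideal generated by a set is the smallest one containing it. $MT_n$ is the space of multilinear elements of $F\langle X,\mathrm{Tr}\rangle$ in $x_1,\dots,x_n$, i.e. the span of all $\mathrm{Tr}(x_{i_1}\cdots x_{i_a})\cdots \mathrm{Tr}(x_{j_1}\cdots x_{j_b})x_{l_1}\cdots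 x_{l_c}$ in which each of $x_1,\dots,x_n$ occurs exactly once (possibly no traces, possibly no letters outside traces). $c_n^{tr}(A)=\dim_F MT_n/(MT_n\cap \mathrm{Id}^{tr}(A))$. $[a,b]=ab-ba$. $D_2$ is the algebra of $2\times2$ diagonal matrices over $F$, and $D_2^{t_{\alpha,\beta}}$ is $D_2$ with the trace $t_{\alpha,\beta}(\mathrm{diag}(a,b))=\alpha a+\beta b$. *)

(* Defs.v *)
From HB Require Import structures.
From mathcomp Require Import all_boot all_order all_algebra.
From mathcomp Require Import generic_quotient finmap.
From mathcomp.multinomials Require Import monalg.

Set Implicit Arguments.
Unset Strict Implicit.
Unset Printing Implicit Defensive.

Import GRing.Theory.

Local Open Scope ring_scope.
Local Open Scope quotient_scope.

(* Words in X = {x_1, x_2, ...} are sequences of natural numbers, the letter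
   [i : nat] standing for x_{i+1}. *)
Definition nzword := {w : seq nat | w != [::]}.

(* [rot k (M ++ N) = N ++ M] for [k = size M], so this is the relation
   MN ~ NM imposed by Tr(MN) = Tr(NM). *)
Definition conj_word (u v : nzword) : bool :=
  has (fun k => val v == rot k (val u)) (iota 0 (size (val u)).+1).

Lemma conj_wordP (u v : nzword) :
  reflect (exists k, val v = rot k (val u)) (conj_word u v).
Proof.
apply: (iffP hasP) => [[k _ /eqP e]|[k e]]; first by exists k.
have [lek|ltk] := leqP k (size (val u)).
  by exists k; rewrite ?mem_iota ?ltnS ?e.
by exists 0%N; rewrite ?mem_iota // e rot_oversize ?rot0 // ltnW.
Qed.

Lemma conj_word_refl : reflexive conj_word.
Proof. by move=> u; apply/conj_wordP; exists 0%N; rewrite rot0. Qed.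

Lemma conj_word_sym : symmetric conj_word.
Proof.
have sub u v : conj_word u v -> conj_word v u.
  case/conj_wordP=> k e; apply/conj_wordP.
  by exists (size (val v) - k)%N; rewrite -[LHS](rotK k) -e.
by move=> u v; apply/idP/idP; apply: sub.
Qed.

Lemma conj_word_trans : transitive conj_word.
Proof.
move=> v u w /conj_wordP [k e] /conj_wordP [l f]; apply/conj_wordP.
have [ltk|lek] := ltnP k (size (val u)); last first.
  by exists l; rewrite f e (rot_oversize lek).
have [ltl|lel] := ltnP l (size (val v)); last first.
  by exists k; rewrite f (rot_oversize lel).
have le1 : (l <= size (val u))%N by rewrite -(size_rot k) -e ltnW.
have le2 : (k <= size (val u))%N by rewrite ltnW.
by eexists; rewrite f e (rot_add_mod le2 le1).
Qed.

Definition conj_word_equiv :=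
  EquivRel conj_word conj_word_refl conj_word_sym conj_word_trans.
Canonical conj_word_equiv.

Definition cycword := {eq_quot conj_word_equiv}.
HB.instance Definition _ := Choice.on cycword.

Section ProdMonom.
Variables M N : monomType.
Implicit Types x y : (M * N)%type.

Definition prod_mul x y := (mmul x.1 y.1, mmul x.2 y.2).

Lemma prod_mulA : associative prod_mul.
Proof. by move=> x y z; rewrite /prod_mul !mulmA. Qed.

Lemma prod_mul1 : left_id (mone, mone) prod_mul.
Proof. by case=> x y; rewrite /prod_mul !mul1m. Qed.

Lemma prod_mulr1 : right_id (mone, mone) prod_mul.
Proof. by case=> x y; rewrite /prod_mul !mulm1. Qed.

Lemma prod_unitm x y :
  prod_mul x y = (mone, mone) -> x = (mone, mone) /\ y = (mone, mone).
Proof. by case: x y => [a b] [c d] [] /unitm [-> ->] /unitm [-> ->]. Qed.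

HB.instance Definition _ := Choice_isMonomialDef.Build (M * N)%type
  prod_mulA prod_mul1 prod_mulr1 prod_unitm.
End ProdMonom.

(* A trace monomial Tr(M_1)...Tr(M_k) w : a commutative monomial in the
   indeterminates Tr(M), and the word w outside the traces. *)
Definition tmonom := ({cmonom cycword} * {fmonom nat})%type.
HB.instance Definition _ := MonomialDef.on tmonom.

(* The free algebra with trace F<X> (x) F[Tr(M)]. *)
Notation "{ 'freetr' F }" := {malg F[tmonom]}
  (at level 0, format "{ 'freetr'  F }") : type_scope.

Section FreeTrace.
Variable F : fieldType.

Definition letter (i : nat) : {freetr F} := << (mone, fmu i) >>.

(* There is no indeterminate Tr(1); the value at the empty word is junk. *)
Definition Tr_word (w : seq nat) : {freetr F} :=
  if insub w is Some u then << (ucm (\pi_cycword u), mone) >> else 0.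

(* Tr(Tr(M_1)...Tr(M_k) w) = Tr(M_1)...Tr(M_k) Tr(w), extended linearly;
   only meaningful on elements satisfying [proper] below. *)
Definition Tr (f : {freetr F}) : {freetr F} :=
  \sum_(m <- msupp f) f@_m *: (<< (m.1, mone) >> * Tr_word m.2).

(* The elements allowed as x_i |-> g_i, where Tr(1) cannot arise. *)
Definition proper (g : {freetr F}) : Prop :=
  forall m, m \in msupp g -> m.2 <> mone.

(* Replace x_{i+1} by [a i] and the formal trace by [T]; traces take central
   values in all uses, and [T] is invariant under cyclic permutations, so
   that the choice of [repr c] is immaterial. *)
Definition teval (B : lalgType F) (T : B -> B) (a : nat -> B)
    (f : {freetr F}) : B :=
  \sum_(m <- msupp f) f@_m *:
    ((\prod_(c <- finsupp m.1) T (\prod_(i <- val (repr c)) a i) ^+ (m.1 c))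
     * \prod_(i <- m.2) a i).

Definition tsubst (g : nat -> {freetr F}) : {freetr F} -> {freetr F} :=
  teval Tr g.

Record trace_T_ideal (I : {freetr F} -> Prop) : Prop := TraceTIdeal {
  tT_zero : I 0;
  tT_add : forall f g, I f -> I g -> I (f + g);
  tT_mull : forall h f, I f -> I (h * f);
  tT_mulr : forall h f, I f -> I (f * h);
  tT_subst : forall g f, (forall i, proper (g i)) -> I f -> I (tsubst g f) }.

Definition generated_trace_T_ideal (S : {freetr F} -> Prop)
    (f : {freetr F}) : Prop :=
  forall I, trace_T_ideal I -> (forall g, S g -> I g) -> I f.

Record trace_map (A : algType F) := TraceMap {
  trace_fun :> {scalar A};
  trace_mulC : forall a b : A, trace_fun (a * b) = trace_fun (b * a) }.

Definition Id_tr (A : algType F) (tr : trace_map A) (f : {freetr F}) : Prop :=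
  forall a : nat -> A, teval (fun b => (tr b)%:A) a f = 0.

Definition occ (i : nat) (m : tmonom) : nat :=
  (\sum_(c <- finsupp m.1) m.1 c * count_mem i (val (repr c))
   + count_mem i m.2)%N.

(* A span of monomials is the set of elements supported on them; the
   variables x_1, ..., x_n are the letters i < n. *)
Definition MT (n : nat) (f : {freetr F}) : Prop :=
  forall m, m \in msupp f -> forall i, occ i m = (i < n)%N.

(* [d] is the dimension of U / W: the classes of some b_0, ..., b_{d-1} in U
   form a basis. The value [d] is unique by [quotient_dim_uniq]. *)
Definition quotient_dim (V : lmodType F) (U W : V -> Prop) (d : nat) : Prop :=
  exists b : 'I_d -> V,
  [/\ forall i, U (b i),
      forall c : 'I_d -> F, W (\sum_i c i *: b i) -> forall i, c i = 0
    & forall u, U u -> exists c : 'I_d -> F, W (u - \sum_i c i *: b i)].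

Lemma quotient_dim_uniq (V : lmodType F) (U W : V -> Prop) (d e : nat) :
  W 0 -> (forall a u v, W u -> W v -> W (a *: u + v)) ->
  quotient_dim U W d -> quotient_dim U W e -> d = e.
Proof.
move=> W0 Wlin.
suff le d' e' : quotient_dim U W d' -> quotient_dim U W e' -> (d' <= e')%N.
  by move=> Hd He; apply/eqP; rewrite eqn_leq !le.
case=> b [bU bfree _] [b' [_ _ bspan]].
have [A HA] : exists A : 'I_d' -> {ffun 'I_e' -> F},
    forall i, W (b i - \sum_j A i j *: b' j).
  apply: (@fin_all_exists _ (fun=> {ffun 'I_e' -> F})
    (fun i c => W (b i - \sum_j c j *: b' j))) => i.
  have [c Hc] := bspan _ (bU i); exists [ffun j => c j].
  by under eq_bigr do rewrite ffunE.
pose M : 'M[F]_(d', e') := \matrix_(i, j) A i j.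
suff : row_free M by rewrite /row_free => /eqP <-; apply: rank_leq_col.
rewrite -kermx_eq0; apply/eqP/row_matrixP => k; rewrite row0.
have vM : row k (kermx M) *m M = 0 by rewrite -row_mul mulmx_ker row0.
apply/rowP => i; rewrite [LHS]mxE [RHS]mxE.
apply: (bfree (fun i => kermx M k i)); move: i => _.
have -> : \sum_i kermx M k i *: b i
    = \sum_i kermx M k i *: (b i - \sum_j A i j *: b' j).
  under [RHS]eq_bigr do rewrite scalerBr.
  rewrite sumrB [X in _ - X](_ : _ = 0) ?subr0 //.
  under eq_bigr do rewrite scaler_sumr.
  rewrite exchange_big big1 // => j _.
  under eq_bigr do rewrite scalerA.
  rewrite -scaler_suml.
  rewrite [X in X *: _](_ : _ = (row k (kermx M) *m M) 0 j).
    by rewrite vM mxE scale0r.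
  by rewrite [RHS]mxE; apply: eq_bigr => i _; rewrite [row _ _ _ _]mxE [M _ _]mxE.
elim/big_ind: _ => // [u v Wu Wv|i' _].
  by rewrite -[u]scale1r; apply: Wlin.
by rewrite -[X in W X]addr0; apply: Wlin.
Qed.

(* [c_n^tr(A) = d] *)
Definition trace_codim (A : algType F) (tr : trace_map A) (n d : nat) : Prop :=
  quotient_dim (MT n) (fun f => MT n f /\ Id_tr tr f) d.

End FreeTrace.

Section DiagonalMatrices.
Variable F : fieldType.

Definition diag_pred : {pred 'M[F]_2} := fun M => is_diag_mx M.

Lemma diag_pred_subalg : GRing.subalg_closed diag_pred.
Proof.
split=> [|a u v /is_diag_mxP Hu /is_diag_mxP Hv
         |u v /is_diag_mxP Hu /is_diag_mxP Hv]; apply/is_diag_mxP => i j ne.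
- by rewrite !mxE -val_eqE (negPf ne).
- by rewrite !mxE Hu // Hv // mulr0 addr0.
- rewrite !mxE big1 // => k _; have [e|ne'] := eqVneq (i : nat) k.
    by rewrite (Hv k) ?mulr0 // -e.
  by rewrite Hu ?mul0r.
Qed.

HB.instance Definition _ :=
  GRing.isSubalgClosed.Build F 'M[F]_2 diag_pred diag_pred_subalg.

Definition D2 : Type := {M : 'M[F]_2 | M \in diag_pred}.
HB.instance Definition _ := SubType.on D2.
HB.instance Definition _ := Choice.on D2.
HB.instance Definition _ := [SubChoice_isSubAlgebra of D2 by <:].

Variables alpha beta : F.

Definition t_fun (M : D2) : F := alpha * val M 0 0 + beta * val M 1 1.

Lemma t_fun_scalar : scalar t_fun.
Proof.
move=> c u v; have E : val (c *: u + v) = c *: val u + val v by [].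
rewrite /t_fun E !mxE.
by rewrite !mulrDr addrACA !(mulrCA _ c) -mulrDr.
Qed.

HB.instance Definition _ := GRing.isLinear.Build F D2 F *%R t_fun t_fun_scalar.

Lemma t_fun_mulC (u v : D2) : t_fun (u * v) = t_fun (v * u).
Proof.
have Z (w : D2) : val w 0 1 = 0 /\ val w 1 0 = 0.
  by have /is_diag_mxP H := valP w; rewrite !H.
have [[u1 u2] [v1 v2]] := (Z u, Z v).
have E (x y : D2) : val (x * y) = val x * val y by [].
rewrite /t_fun !E !mxE !big_ord_recl !big_ord0.
rewrite (_ : lift ord0 ord0 = 1) ?u1 ?u2 ?v1 ?v2; last exact: val_inj.
by rewrite !(mul0r, mulr0, addr0, add0r) ![val v _ _ * _]mulrC.
Qed.

Definition t_trace : trace_map D2 := TraceMap t_fun_mulC.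

End DiagonalMatrices.

Section Generators.
Variable F : fieldType.

Local Notation x1 := (letter F 0).
Local Notation x2 := (letter F 1).
Local Notation x3 := (letter F 2).

Definition f1 : {freetr F} := x1 * x2 - x2 * x1.

Variables a b : F.

Definition f4 : {freetr F} :=
  - (x1 * Tr x2 * Tr x3) + (a + b) *: (x1 * Tr (x2 * x3))
  + x3 * Tr x1 * Tr x2 - (a + b) *: (x3 * Tr (x1 * x2))
  - Tr x1 * Tr (x2 * x3) + Tr x3 * Tr (x1 * x2).

Definition f5 : {freetr F} :=
  Tr x1 * Tr x2 * Tr x3
  - (a * b ^+ 2 + a ^+ 2 * b) *: (x1 * x2 * x3)
  + (a * b) *: (x1 * x2 * Tr x3)
  + (a * b) *: (x1 * x3 * Tr x2)
  + (a * b) *: (x2 * x3 * Tr x1)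
  - (a + b) *: (x1 * Tr x2 * Tr x3)
  + (a ^+ 2 + a * b + b ^+ 2) *: (x1 * Tr (x2 * x3))
  - (a * b) *: (x2 * Tr (x1 * x3))
  - (a * b) *: (x3 * Tr (x1 * x2))
  + (a * b) *: Tr (x1 * x2 * x3)
  - (a + b) *: (Tr x1 * Tr (x2 * x3)).

End Generators.

(* Main.v *)
From HB Require Import structures.
Require Import Defs.
From mathcomp Require Import all_boot all_algebra.
From mathcomp Require Import generic_quotient finmap.
From mathcomp.multinomials Require Import monalg.
From mathcomp Require Import ring zify.

Set Implicit Arguments.
Unset Strict Implicit.
Unset Printing Implicit Defensive.

Import GRing.Theory.
Local Open Scope ring_scope.
Local Open Scope quotient_scope.
Local Notation proper := Defs.proper.

(** Write D = alpha * beta.  Modulo the trace T-ideal J of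
    the three polynomials, every trace monomial is a combination of the normal
    forms

      x_u,   x_u Tr(x_v)  (v nonempty),   x_u Tr(x_i) Tr(x_w)  (w nonempty, i <= min w),

    where u, v, w are sorted words, and these normal forms are linearly
    independent as functions on the diagonal matrices.  Since J consists of
    identities, an identity f is congruent modulo J to a combination of normal
    forms that is itself an identity, hence zero, so f lies in J.

    Reduction ([reduce_tev]).  The polynomial f1 makes letters commute.  In
    f5(p, q, r) - f5(p, r, q) everything cancels modulo f1 except
    D (Tr(pqr) - Tr(prq)), and D is nonzero, so the letters inside a trace
    commute as well.  Then f5 expresses a product of three traces through terms
    with at most two.  Finally f4(x_i, v, w) rewrites Tr(x_i v) Tr(w) through
    Tr(x_i) Tr(v w), terms with one trace, and products of two traces of
    smaller total length or with a trace Tr(x_i); taking for i the least letter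
    inside the traces gives the normal forms.  None of these steps changes the
    multidegree.

    Independence ([nfval_free]).  On generic diagonal matrices with entries
    (a_i, b_i), the first component of a normal form is a combination of
    bimonomials a_u b_v.  As functions on the pairs (a, b) the bimonomials are
    distinct multiplicative characters in characteristic 0, so they are
    independent and coefficients can be compared.  Let c(u, v) and e(u, v) be
    the coefficients of x_u Tr(x_v) and of x_u Tr(x_i) Tr(x_w) with v = iw.  For
    v of length at least 2, the bimonomial a_u b_v yields
      beta c(u, v) + beta^2 e(u, v) + D S(u, v) = 0,
    where S(u, v) is the sum of the e(u - j, jv) over the distinct letters
    j <= min v of u.  The second component yields the same equation with alpha
    and beta exchanged.  Subtracting, (alpha - beta) (S(u, v) - e(u, v)) = 0.
    So e(u, v) = S(u, v) only involves coefficients with a shorter first word,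
    and induction on the length of u gives e = 0, after which c = 0 is
    immediate.

    Codimension ([trace_codim_D2]).  The multilinear normal forms in x_1, ...,
    x_n are given by the subset of letters inside the traces: 2^n with at most
    one trace, and one more for each of the 2^n - n - 1 subsets with at least
    two letters. *)

(** * Linear extension from a basis *)

Lemma linear_comp (F : fieldType) (U V W : lmodType F) (L : V -> W) (M : U -> V) :
  linear L -> linear M -> linear (fun x => L (M x)).
Proof. by move=> lL lM c x y; rewrite lM lL. Qed.

Definition subspace (F : fieldType) (V : lmodType F) (P : V -> Prop) : Prop :=
  P 0 /\ forall c u v, P u -> P v -> P (c *: u + v).

Section Subspace.
Variables (F : fieldType) (V : lmodType F) (P : V -> Prop).
Hypothesis sP : subspace P.

Lemma subspaceD u v : P u -> P v -> P (u + v).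
Proof. by move=> Pu Pv; rewrite -[u]scale1r; apply: sP.2. Qed.

Lemma subspaceZ c u : P u -> P (c *: u).
Proof. by move=> Pu; rewrite -[_ *: _]addr0; apply: sP.2 => //; apply: sP.1. Qed.

Lemma subspaceN u : P u -> P (- u).
Proof. by rewrite -scaleN1r; apply: subspaceZ. Qed.

Lemma subspaceB u v : P u -> P v -> P (u - v).
Proof. by move=> Pu Pv; apply: subspaceD => //; apply: subspaceN. Qed.

Lemma subspace_sum (I : eqType) (s : seq I) (f : I -> V) :
  {in s, forall i, P (f i)} -> P (\sum_(i <- s) f i).
Proof.
move=> Pf; rewrite big_seq; elim/big_rec: _ => [|i v si Pv]; first exact: sP.1.
by apply: subspaceD => //; apply: Pf.
Qed.

End Subspace.

Section LinearExtension.
Variables (F : fieldType) (K : choiceType).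
Implicit Types f g : {malg F[K]}.

Lemma malg_monomE f : f = \sum_(k <- msupp f) f@_k *: << k >>.
Proof.
rewrite {1}[f]monalgE; apply: eq_bigr => k _; apply/malgP => l.
by rewrite mcoeffZ !mcoeffU mulr_natr.
Qed.

(** The induction principle used for all statements about linear combinations
    of monomials. *)
Lemma malg_subspace (P : {malg F[K]} -> Prop) f :
  subspace P -> {in msupp f, forall k, P << k >>} -> P f.
Proof.
move=> sP Pk; rewrite [f]malg_monomE; apply: subspace_sum => // k fk.
by apply: subspaceZ => //; apply: Pk.
Qed.

Variable V : lmodType F.

Lemma linear_eq_monom (L L' : {malg F[K]} -> V) f : linear L -> linear L' ->
  {in msupp f, forall k, L << k >> = L' << k >>} -> L f = L' f.
Proof.
move=> lL lL' e; apply: (malg_subspace (P := fun f => L f = L' f)) e.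
have L0 (M : {malg F[K]} -> V) : linear M -> M 0 = 0.
  by move=> /(_ (-1) 0 0); rewrite scaler0 addr0 scaleN1r addNr.
by split=> [|c u v eu ev]; rewrite ?L0 // lL lL' eu ev.
Qed.

Implicit Type h : K -> V.

Definition lext h f : V := \sum_(k <- msupp f) f@_k *: h k.

Lemma lextEw h f (d : {fset K}) : (msupp f `<=` d)%fset ->
  lext h f = \sum_(k <- d) f@_k *: h k.
Proof.
move=> le; rewrite /lext (big_fset_incl _ le) //= => k _ /mcoeff_outdom ->.
by rewrite scale0r.
Qed.

Lemma lext_linear h : linear (lext h).
Proof.
move=> c f g; set d := (msupp f `|` msupp g)%fset.
have df : (msupp f `<=` d)%fset by rewrite fsubsetUl.
have dg : (msupp g `<=` d)%fset by rewrite fsubsetUr.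
have ds : (msupp (c *: f + g)%R `<=` d)%fset.
  apply: fsubset_trans (msuppD_le _ _) _.
  by rewrite fsubUset dg (fsubset_trans (msuppZ_le _ _)).
rewrite (lextEw h df) (lextEw h dg) (lextEw h ds) scaler_sumr -big_split /=.
by apply: eq_bigr => k _; rewrite mcoeffD mcoeffZ scalerDl scalerA.
Qed.

HB.instance Definition _ h :=
  GRing.isLinear.Build F {malg F[K]} V *:%R (lext h) (lext_linear h).

Lemma lextU h k : lext h << k >> = h k.
Proof. by rewrite /lext msuppU oner_eq0 big_seq_fset1 mcoeffUU scale1r. Qed.

End LinearExtension.

(** * Commutative monomials as lists *)

Section MonomialList.
Variable I : choiceType.
Implicit Types m : cmonom I.

(** As a list with multiplicities, so that a product of powers indexed by the
    support becomes a product over a list, additive in the monomial up to a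
    permutation. *)
Definition cmseq m : seq I := flatten [seq nseq (m i) i | i <- finsupp m].

Lemma count_cmseq m i : count_mem i (cmseq m) = m i.
Proof.
rewrite /cmseq count_flatten sumnE !big_map.
under eq_bigr do rewrite count_nseq /=.
case: (mdomP m i) => im.
  by rewrite (big_fsetD1 i) //= eqxx mul1n big1_fset ?addn0 // => j;
     rewrite in_fsetD1 => /andP [/negPf ->].
rewrite big_seq big1 // => j jm; case: eqP => // e.
by move: im; rewrite -e jm.
Qed.

Lemma perm_count_mem (T : eqType) (s t : seq T) :
  (forall x, count_mem x s = count_mem x t) -> perm_eq s t.
Proof. by move=> e; apply/allP => x _; rewrite /= e. Qed.

Lemma cmseqM m1 m2 : perm_eq (cmseq (mmul m1 m2)) (cmseq m1 ++ cmseq m2).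
Proof. by apply: perm_count_mem => i; rewrite count_cat !count_cmseq cmM. Qed.

Lemma cmseq1 : cmseq mone = [::].
Proof.
by apply: perm_nilP; apply: perm_count_mem => i; rewrite count_cmseq cm1.
Qed.

Lemma cmseqU i : cmseq (ucm i) = [:: i].
Proof.
apply: perm_small_eq => //; apply: perm_count_mem => j.
by rewrite count_cmseq cmU /= addn0.
Qed.

Lemma prod_cmseq (R : nzRingType) m (f : I -> R) :
  \prod_(i <- cmseq m) f i = \prod_(i <- finsupp m) f i ^+ m i.
Proof.
rewrite /cmseq big_flatten big_map; apply: eq_bigr => i _.
by rewrite big_nseq iter_mulr_1.
Qed.

Lemma sum_cmseq m (f : I -> nat) :
  (\sum_(i <- cmseq m) f i = \sum_(i <- finsupp m) m i * f i)%N.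
Proof.
rewrite /cmseq big_flatten big_map; apply: eq_bigr => i _.
by rewrite big_nseq iter_addn_0 mulnC.
Qed.
End MonomialList.

Section CentralProduct.
Variable R : nzRingType.

Definition central (x : R) : Prop := forall y, x * y = y * x.

Lemma central1 : central 1.
Proof. by move=> y; rewrite mul1r mulr1. Qed.

Lemma centralM x y : central x -> central y -> central (x * y).
Proof. by move=> cx cy z; rewrite -mulrA cy !mulrA cx. Qed.

Lemma central_prod (I : Type) (s : seq I) (f : I -> R) :
  (forall i, central (f i)) -> central (\prod_(i <- s) f i).
Proof.
move=> cf; elim/big_rec: _ => [|i x _ cx]; first exact: central1.
exact: centralM.
Qed.

Lemma perm_big_central (I : eqType) (s t : seq I) (f : I -> R) :
  (forall i, central (f i)) -> perm_eq s t ->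
  \prod_(i <- s) f i = \prod_(i <- t) f i.
Proof.
move=> cf st; pose P t := \prod_(i <- s) f i = \prod_(i <- t) f i.
apply: (@catCA_perm_ind _ P _ s t) => // s1 s2 s3; rewrite /P => ->.
by rewrite !big_cat /= mulrA central_prod // mulrA.
Qed.

End CentralProduct.

(** * Words and traces of words *)

Section Words.

Lemma eq_pi_rot (u v : nzword) : \pi_cycword u = \pi_cycword v ->
  exists k, val v = rot k (val u).
Proof. by move=> /eqmodP uv; apply/conj_wordP; exact: uv. Qed.

(** What makes evaluation independent of the representative chosen for a cyclic
    word, as soon as the trace is invariant under cyclic permutations. *)
Lemma repr_pi_rot (u : nzword) :
  exists k, val (repr (\pi_cycword u)) = rot k (val u).
Proof. by apply: eq_pi_rot; rewrite [RHS]reprK. Qed.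

Definition word (w : seq nat) : tmonom := (mone, FMonom w).

Definition trmon (c : {cmonom cycword}) : tmonom := (c, mone).

Lemma word0 : word [::] = mone.
Proof. by congr pair; apply: val_inj; rewrite /= fm1. Qed.

Lemma wordM u v : mmul (word u) (word v) = word (u ++ v).
Proof. by congr pair; [rewrite mul1m | apply: val_inj; rewrite /= fmM]. Qed.

Lemma trmonM c d : mmul (trmon c) (trmon d) = trmon (mmul c d).
Proof. by congr pair; rewrite /= mulm1. Qed.

Lemma tmonom_split (m : tmonom) : m = mmul (trmon m.1) (word m.2).
Proof.
case: m => c [w]; congr pair; first by rewrite /= mulm1.
by rewrite /= -[LHS]mul1m.
Qed.

Lemma occM i (m1 m2 : tmonom) : occ i (mmul m1 m2) = (occ i m1 + occ i m2)%N.
Proof.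
rewrite /occ -!sum_cmseq /= (perm_big _ (cmseqM _ _)) /= big_cat /=.
by rewrite fmM count_cat addnACA.
Qed.

Lemma occ_word i w : occ i (word w) = count_mem i w.
Proof. by rewrite /occ -sum_cmseq cmseq1 big_nil. Qed.

Lemma occ_trmon i u : occ i (trmon (ucm (\pi_cycword u))) = count_mem i (val u).
Proof.
rewrite /occ -sum_cmseq cmseqU big_seq1 fm1 addn0.
have [k ->] := repr_pi_rot u; apply/permP.
by rewrite perm_rot.
Qed.

End Words.

(** Sealed, so that basis elements are compared by their monomials instead of
    by the underlying finitely supported functions. *)
HB.lock Definition mon (F : fieldType) (m : tmonom) : {freetr F} := << m >>.

Section FreeTrace.
Variable F : fieldType.
Implicit Types f g h : {freetr F}.
Implicit Types m : tmonom.

Local Notation mon := (mon F).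

Lemma monE m : << m >> = mon m. Proof. by rewrite mon.unlock. Qed.

Lemma monM m1 m2 : mon m1 * mon m2 = mon (mmul m1 m2).
Proof. by rewrite mon.unlock malgM_def fgmulUU mulr1. Qed.

Lemma mon1 : mon mone = 1. Proof. by rewrite -monE. Qed.

Lemma msupp_mon m m' : (m \in msupp (mon m')) = (m == m').
Proof. by rewrite -monE msuppU oner_eq0 inE. Qed.

Lemma freetr_subspace (P : {freetr F} -> Prop) f :
  subspace P -> (forall m, m \in msupp f -> P (mon m)) -> P f.
Proof. by move=> sP Pm; apply: malg_subspace => // m fm; rewrite monE; apply: Pm. Qed.

Lemma freetr_linear_eq (V : lmodType F) (L L' : {freetr F} -> V) f :
  linear L -> linear L' ->
  (forall m, m \in msupp f -> L (mon m) = L' (mon m)) -> L f = L' f.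
Proof. by move=> lL lL' e; apply: linear_eq_monom => // m fm; rewrite monE; apply: e. Qed.

Lemma freetr_scalerAl c f g : (c *: f) * g = c *: (f * g).
Proof. by rewrite scalerAl. Qed.

Lemma freetr_mull_linear g : linear (fun f => f * g).
Proof. by move=> c u v; rewrite mulrDl freetr_scalerAl. Qed.

(** Over a noncommutative monoid the scalars act centrally because they commute
    with every monomial. *)
Lemma freetr_scalerAr c f g : f * (c *: g) = c *: (f * g).
Proof.
have sl d : linear (fun h : {freetr F} => d *: h).
  by move=> e u v; rewrite scalerDr !scalerA (mulrC d).
apply: (freetr_linear_eq (freetr_mull_linear _) (linear_comp (sl c) (freetr_mull_linear g))).
move=> m _; move: c; apply: (@freetr_subspace
    (fun g => forall c, mon m * (c *: g) = c *: (mon m * g))).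
  split=> [c|d u v /= eu ev c]; first by rewrite scaler0 mulr0 scaler0.
  by rewrite scalerDr scalerA !mulrDr !eu ev scalerDr !scalerA.
move=> m' _ c; rewrite monM mon.unlock.
have scaleU d (k : tmonom) : d *: << k >> = << d *g k >> :> {freetr F}.
  by apply/malgP => k'; rewrite mcoeffZ !mcoeffU mulr_natr.
by rewrite !scaleU malgM_def fgmulUU mul1r.
Qed.

Lemma freetr_mulr_linear f : linear (fun g => f * g).
Proof. by move=> c u v; rewrite mulrDr freetr_scalerAr. Qed.

Definition X (w : seq nat) : {freetr F} := mon (word w).

Lemma X0 : X [::] = 1. Proof. by rewrite /X word0 mon1. Qed.

Lemma XM u v : X u * X v = X (u ++ v).
Proof. by rewrite /X monM wordM. Qed.

Lemma X_letter i : letter F i = X [:: i].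
Proof.
rewrite /X -monE /letter; suff -> : word [:: i] = (mone, fmu i) by [].
by congr pair; apply: val_inj; rewrite /= fmU.
Qed.

(** The centre of the free algebra with trace contains the polynomials in the
    traces. *)
Lemma central_trmon c : central (mon (trmon c)).
Proof.
move=> g; apply: (freetr_linear_eq (freetr_mulr_linear _) (freetr_mull_linear _)).
move=> m _; rewrite !monM; congr (mon _).
by congr pair; [rewrite mulmC | rewrite /= mul1m mulm1].
Qed.

Lemma Tr_wordE (u : nzword) : Tr_word F (val u) = mon (trmon (ucm (\pi_cycword u))).
Proof. by rewrite /Tr_word valK -monE. Qed.

Lemma Tr_word_nz w (nz : w != [::]) :
  Tr_word F w = mon (trmon (ucm (\pi_cycword (Sub w nz : nzword)))).
Proof. by rewrite -Tr_wordE. Qed.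

Lemma Tr_word0 : Tr_word F [::] = 0.
Proof. by rewrite /Tr_word insubF. Qed.

Lemma Tr_word_repr (c : cycword) : Tr_word F (val (repr c)) = mon (trmon (ucm c)).
Proof. by rewrite Tr_wordE reprK. Qed.

Lemma Tr_word_rot k w : Tr_word F (rot k w) = Tr_word F w.
Proof.
have [->|nz] := eqVneq w [::]; first by rewrite /rot.
have nz' : rot k w != [::] by rewrite -size_eq0 size_rot size_eq0.
rewrite (Tr_word_nz nz) (Tr_word_nz nz'); congr (mon (trmon (ucm _))).
by apply/esym/eqmodP/conj_wordP; exists k.
Qed.

Lemma Tr_word_catC u v : Tr_word F (u ++ v) = Tr_word F (v ++ u).
Proof. by rewrite -(Tr_word_rot (size u)) rot_size_cat. Qed.

Lemma central_Tr_word w : central (Tr_word F w).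
Proof.
have [->|nz] := eqVneq w [::]; last by rewrite (Tr_word_nz nz); apply: central_trmon.
by rewrite Tr_word0 => y; rewrite mul0r mulr0.
Qed.

Lemma TrE f : Tr f = lext (fun m : tmonom => mon (trmon m.1) * Tr_word F m.2) f.
Proof. by rewrite mon.unlock. Qed.

Lemma Tr_mon m : Tr (mon m) = mon (trmon m.1) * Tr_word F m.2.
Proof. by rewrite TrE -[mon m]monE lextU. Qed.

Lemma Tr_linear : linear (@Tr F).
Proof. by move=> c f g; rewrite !TrE linearP. Qed.

Lemma Tr0 : Tr (0 : {freetr F}) = 0.
Proof. by rewrite TrE linear0. Qed.

Lemma Tr_X w : Tr (X w) = Tr_word F w.
Proof. by rewrite Tr_mon -[mon _]/(mon mone) mon1 mul1r. Qed.

Lemma mon_decomp m :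
  mon m = (\prod_(c <- cmseq m.1) Tr_word F (val (repr c))) * X m.2.
Proof.
rewrite {1}(tmonom_split m) -monM; congr (_ * _); move: m.1 => {m} c.
pose cm s : cmonom cycword := \big[mmul/mone]_(d <- s) ucm d.
have {1}-> : c = cm (cmseq c).
  apply/eqP/cmP => i; rewrite -count_cmseq; elim: (cmseq c) => [|j s IH].
    by rewrite /cm big_nil cm1.
  by rewrite /cm big_cons cmM -/(cm s) -IH cmU.
elim: (cmseq c) => [|d s IH]; first by rewrite /cm !big_nil -mon1.
by rewrite /cm !big_cons -IH Tr_word_repr monM trmonM.
Qed.

End FreeTrace.

(** * Substitution *)

(** The properties of a formal or scalar-valued trace that make evaluation of
    trace polynomials a homomorphism; both Tr on the free algebra and
    b |-> tr(b) 1 on an algebra with trace have them.  The last clause makes up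
    for the fact that B is only a left algebra. *)
Record central_trace (F : fieldType) (B : lalgType F) (T : B -> B) : Prop :=
  CentralTrace {
    ct_linear : linear T;
    ct_central : forall x, central (T x);
    ct_mulC : forall x y, T (x * y) = T (y * x);
    ct_pull : forall x y, T (T x * y) = T x * T y;
    ct_scalerAr : forall c (x y : B), x * (c *: y) = c *: (x * y) }.

Section Proper.
Variable F : fieldType.
Implicit Types f g : {freetr F}.

Lemma proper_X w : w != [::] -> proper (X F w).
Proof.
move=> nz m; rewrite msupp_mon => /eqP -> /= e.
by move: nz; rewrite -[w]/(fmonom_val (FMonom w)) e /= fm1.
Qed.

Lemma proper_mull f g : proper f -> proper (f * g).
Proof.
move=> pf m /msuppM_le [m1 [m2 [m1f _ ->]]] /= /unitm [e _].
exact: pf m1f e.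
Qed.

Lemma proper_letter i : proper (letter F i).
Proof. by rewrite X_letter; apply: proper_X. Qed.

End Proper.

Section RelationValues.
Variables (F : fieldType) (B : lalgType F) (T : B -> B) (al be : F).

(** The polynomials f4 and f5 as functions on any algebra with a trace; T may be
    the formal trace, which gives their substitution instances, or a scalar
    trace, which gives their values. *)
Definition rel4 (x y z : B) : B :=
  - (x * T y * T z) + (al + be) *: (x * T (y * z)) + z * T x * T y
  - (al + be) *: (z * T (x * y)) - T x * T (y * z) + T z * T (x * y).

Definition rel5 (x y z : B) : B :=
  T x * T y * T z - (al * be ^+ 2 + al ^+ 2 * be) *: (x * y * z)
  + (al * be) *: (x * y * T z) + (al * be) *: (x * z * T y)
  + (al * be) *: (y * z * T x) - (al + be) *: (x * T y * T z)
  + (al ^+ 2 + al * be + be ^+ 2) *: (x * T (y * z))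
  - (al * be) *: (y * T (x * z)) - (al * be) *: (z * T (x * y))
  + (al * be) *: T (x * y * z) - (al + be) *: (T x * T (y * z)).

End RelationValues.

Section Teval.
Variables (F : fieldType) (B : lalgType F) (T : B -> B).
Hypothesis ctT : central_trace T.
Implicit Types (a : nat -> B) (f g : {freetr F}).

(** The value of a monomial, with the powers of traces spread over a list. *)
Definition tev a (m : tmonom) : B :=
  (\prod_(c <- cmseq m.1) T (\prod_(i <- val (repr c)) a i)) * \prod_(i <- m.2) a i.

Lemma tevalE a f : teval T a f = lext (tev a) f.
Proof. by apply: eq_bigr => m _; rewrite /tev prod_cmseq. Qed.

Lemma teval_linear a : linear (teval T a).
Proof. by move=> c f g; rewrite !tevalE linearP. Qed.

HB.instance Definition _ a :=
  GRing.isLinear.Build F {freetr F} B *:%R (teval T a) (teval_linear a).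

Lemma teval_mon a m : teval T a (mon F m) = tev a m.
Proof. by rewrite tevalE -monE lextU. Qed.

Lemma tevM a m1 m2 : tev a (mmul m1 m2) = tev a m1 * tev a m2.
Proof.
have cT (c : cycword) : central (T (\prod_(i <- val (repr c)) a i)) by apply: ct_central.
rewrite /tev (perm_big_central _ (cmseqM _ _)) // big_cat /= fmM big_cat /=.
rewrite -!mulrA; congr (_ * _).
by rewrite mulrA (central_prod _ cT (\prod_(i <- m1.2) a i)) -mulrA.
Qed.

Let mull_linear y : linear (fun x : B => x * y).
Proof. by move=> c u v; rewrite mulrDl scalerAl. Qed.

Let mulr_linear x : linear (fun y : B => x * y).
Proof. by move=> c u v; rewrite mulrDr (ct_scalerAr ctT). Qed.

(** Evaluation is multiplicative because the values of the trace are central. *)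
Lemma tevalM a f g : teval T a (f * g) = teval T a f * teval T a g.
Proof.
have lt := teval_linear a.
apply: (freetr_linear_eq (linear_comp lt (freetr_mull_linear g))
                        (linear_comp (mull_linear _) lt)) => m _.
apply: (freetr_linear_eq (linear_comp lt (freetr_mulr_linear _))
                        (linear_comp (mulr_linear _) lt)).
by move=> m' _; rewrite monM !teval_mon tevM.
Qed.

Lemma teval_X a w : teval T a (X F w) = \prod_(i <- w) a i.
Proof. by rewrite teval_mon /tev cmseq1 big_nil mul1r. Qed.

Lemma teval1 a : teval T a 1 = 1.
Proof. by rewrite -(X0 F) teval_X big_nil. Qed.

Lemma teval_letter a i : teval T a (letter F i) = a i.
Proof. by rewrite X_letter teval_X big_seq1. Qed.

Lemma T_prod_rot a k w :
  T (\prod_(i <- rot k w) a i) = T (\prod_(i <- w) a i).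
Proof. by rewrite -{2}(cat_take_drop k w) !big_cat /= (ct_mulC ctT). Qed.

Lemma teval_Tr_word a w : w != [::] ->
  teval T a (Tr_word F w) = T (\prod_(i <- w) a i).
Proof.
move=> nz; rewrite (Tr_word_nz F nz) teval_mon /tev cmseqU big_seq1.
rewrite fm1 big_nil mulr1; have [k ->] := repr_pi_rot (Sub w nz).
by rewrite T_prod_rot.
Qed.

Lemma T_pull_prod (I : Type) (s : seq I) (e : I -> B) y :
  T ((\prod_(i <- s) T (e i)) * y) = (\prod_(i <- s) T (e i)) * T y.
Proof.
elim: s => [|i s IH]; first by rewrite big_nil !mul1r.
by rewrite big_cons -mulrA (ct_pull ctT) IH mulrA.
Qed.

(** Tr(1) does not exist in the free algebra, so a constant term would break
    this equation. *)
Lemma teval_Tr a f : proper f -> teval T a (Tr f) = T (teval T a f).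
Proof.
move=> pf; have lt := teval_linear a.
apply: (freetr_linear_eq (linear_comp lt (@Tr_linear F)) (linear_comp (ct_linear ctT) lt)).
move=> m /pf m2; rewrite Tr_mon tevalM teval_Tr_word; last first.
  by apply/eqP => e; apply: m2; apply: val_inj; rewrite /= e fm1.
by rewrite !teval_mon /tev T_pull_prod /= fm1 big_nil mulr1.
Qed.

(** Evaluation as a relation compatible with the operations: the derivations
    below follow the syntax tree of f4 and f5, instead of searching it by
    rewriting. *)
Definition teval_to a f b := teval T a f = b.

Section TevalTo.
Variable a : nat -> B.
Local Notation "f ~> b" := (teval_to a f b) (at level 70).

Lemma teval_toD f g b c : f ~> b -> g ~> c -> f + g ~> b + c.
Proof. by move=> <- <-; apply: linearD. Qed.

Lemma teval_toN f b : f ~> b -> - f ~> - b.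
Proof. by move=> <-; apply: linearN. Qed.

Lemma teval_toZ c f b : f ~> b -> c *: f ~> c *: b.
Proof. by move=> <-; apply: linearZ. Qed.

Lemma teval_toM f g b c : f ~> b -> g ~> c -> f * g ~> b * c.
Proof. by move=> <- <-; apply: tevalM. Qed.

Lemma teval_to_Tr f b : proper f -> f ~> b -> Tr f ~> T b.
Proof. by move=> pf <-; apply: teval_Tr. Qed.

Local Notation e := (teval_letter a).

Let tr1 i : Tr (letter F i) ~> T (a i).
Proof. apply: teval_to_Tr; [exact: proper_letter | exact: teval_letter]. Qed.

Let tr2 i j : Tr (letter F i * letter F j) ~> T (a i * a j).
Proof.
apply: teval_to_Tr; first by apply: proper_mull; apply: proper_letter.
exact: (teval_toM (e i) (e j)).
Qed.

Lemma teval_f1 : teval T a (f1 F) = a 0 * a 1 - a 1 * a 0.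
Proof. exact: (teval_toD (teval_toM (e 0) (e 1)) (teval_toN (teval_toM (e 1) (e 0)))). Qed.

Variables al be : F.

Lemma teval_f4 : teval T a (f4 al be) = rel4 T al be (a 0) (a 1) (a 2).
Proof.
apply: (teval_toD _ (teval_toM (tr1 2) (tr2 0 1))).
apply: (teval_toD _ (teval_toN (teval_toM (tr1 0) (tr2 1 2)))).
apply: (teval_toD _ (teval_toN (teval_toZ _ (teval_toM (e 2) (tr2 0 1))))).
apply: (teval_toD _ (teval_toM (teval_toM (e 2) (tr1 0)) (tr1 1))).
apply: (teval_toD _ (teval_toZ _ (teval_toM (e 0) (tr2 1 2)))).
exact: (teval_toN (teval_toM (teval_toM (e 0) (tr1 1)) (tr1 2))).
Qed.

Lemma teval_f5 : teval T a (f5 al be) = rel5 T al be (a 0) (a 1) (a 2).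
Proof.
apply: (teval_toD _ (teval_toN (teval_toZ _ (teval_toM (tr1 0) (tr2 1 2))))).
have tr3 : Tr (letter F 0 * letter F 1 * letter F 2) ~> T (a 0 * a 1 * a 2).
  apply: teval_to_Tr; first by do 2!apply: proper_mull; apply: proper_letter.
  exact: (teval_toM (teval_toM (e 0) (e 1)) (e 2)).
apply: (teval_toD _ (teval_toZ _ tr3)).
apply: (teval_toD _ (teval_toN (teval_toZ _ (teval_toM (e 2) (tr2 0 1))))).
apply: (teval_toD _ (teval_toN (teval_toZ _ (teval_toM (e 1) (tr2 0 2))))).
apply: (teval_toD _ (teval_toZ _ (teval_toM (e 0) (tr2 1 2)))).
apply: (teval_toD _ (teval_toN (teval_toZ _ (teval_toM (teval_toM (e 0) (tr1 1)) (tr1 2))))).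
apply: (teval_toD _ (teval_toZ _ (teval_toM (teval_toM (e 1) (e 2)) (tr1 0)))).
apply: (teval_toD _ (teval_toZ _ (teval_toM (teval_toM (e 0) (e 2)) (tr1 1)))).
apply: (teval_toD _ (teval_toZ _ (teval_toM (teval_toM (e 0) (e 1)) (tr1 2)))).
apply: (teval_toD _ (teval_toN (teval_toZ _ (teval_toM (teval_toM (e 0) (e 1)) (e 2))))).
exact: (teval_toM (teval_toM (tr1 0) (tr1 1)) (tr1 2)).
Qed.

End TevalTo.

End Teval.

Section FreeTeval.
Variable F : fieldType.
Implicit Types f g : {freetr F}.

Lemma central_trace_Tr : central_trace (@Tr F).
Proof.
have lT := @Tr_linear F; have ll := @freetr_mull_linear F; have lr := @freetr_mulr_linear F.
split.
- exact: Tr_linear.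
- move=> f y; apply: (freetr_linear_eq (linear_comp (ll y) lT) (linear_comp (lr y) lT)) => m _.
  rewrite Tr_mon; apply: centralM; first exact: central_trmon.
  exact: central_Tr_word.
- move=> f g; apply: (freetr_linear_eq (linear_comp lT (ll g)) (linear_comp lT (lr g))) => m _.
  apply: (freetr_linear_eq (linear_comp lT (lr _)) (linear_comp lT (ll _))) => m' _.
  rewrite !monM !Tr_mon /= !fmM Tr_word_catC.
  by rewrite (mulmC m.1).
- move=> f g.
  apply: (freetr_linear_eq (linear_comp lT (linear_comp (ll g) lT))
                           (linear_comp (ll _) lT)) => m _.
  apply: (freetr_linear_eq (linear_comp lT (lr _)) (linear_comp (lr _) lT)) => m' _.
  rewrite !Tr_mon; have [e|nz] := eqVneq (m.2 : seq nat) [::].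
    by rewrite e Tr_word0 mulr0 !mul0r Tr0.
  rewrite (Tr_word_nz F nz) !monM Tr_mon /= mulrA monM.
  by rewrite !fmM !fm1 !trmonM.
- by move=> c f g; rewrite freetr_scalerAr.
Qed.

Lemma proper_prod (g : nat -> {freetr F}) w :
  w != [::] -> (forall i, proper (g i)) -> proper (\prod_(i <- w) g i).
Proof. by case: w => // i w _ pg; rewrite big_cons; apply: proper_mull. Qed.

Variables (B : lalgType F) (T : B -> B).
Hypothesis ctT : central_trace T.

Lemma teval_prod (I : Type) a (s : seq I) (e : I -> {freetr F}) :
  teval T a (\prod_(i <- s) e i) = \prod_(i <- s) teval T a (e i).
Proof.
elim: s => [|i s IH]; first by rewrite !big_nil teval1.
by rewrite !big_cons tevalM // IH.
Qed.

(** Evaluating after a substitution is evaluating at the values of the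
    substituted elements; this is why the identities of an algebra form a trace
    T-ideal.  Properness of g is inherited by the products g_w over nonempty
    words w, which is what [teval_Tr] requires. *)
Lemma teval_tsubst a (g : nat -> {freetr F}) f : (forall i, proper (g i)) ->
  teval T a (tsubst g f) = teval T (fun i => teval T a (g i)) f.
Proof.
move=> pg; rewrite /tsubst.
apply: (freetr_linear_eq
  (linear_comp (@teval_linear _ _ T a) (@teval_linear _ _ (@Tr F) g))
  (@teval_linear _ _ T _)).
move=> m _; rewrite !teval_mon /tev tevalM // !teval_prod; congr (_ * _).
apply: eq_bigr => c _; rewrite teval_Tr // ?teval_prod //.
by apply: proper_prod => //; exact: (valP (repr c)).
Qed.

End FreeTeval.

Section ScalarTrace.
Variables (F : fieldType) (A : algType F) (tr : trace_map A).

Lemma central_trace_scalar : central_trace (fun b : A => (tr b)%:A).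
Proof.
split.
- by move=> c x y; rewrite linearP scalerDl scalerA.
- by move=> x y; rewrite -scalerAl -scalerAr mul1r mulr1.
- by move=> x y; rewrite trace_mulC.
- by move=> x y; rewrite -scalerAl mul1r linearZ /= -scalerA -scalerAl mul1r.
- by move=> c x y; rewrite scalerAr.
Qed.

Lemma trace_T_ideal_Id_tr : trace_T_ideal (Id_tr tr).
Proof.
have ct := central_trace_scalar; split.
- by move=> a; rewrite linear0.
- by move=> f g If Ig a; rewrite linearD /= If Ig addr0.
- by move=> h f If a; rewrite tevalM // If mulr0.
- by move=> h f If a; rewrite tevalM // If mul0r.
- by move=> g f pg If a; rewrite teval_tsubst.
Qed.

End ScalarTrace.

(** * Normal forms *)

Section NormalForm.
Variables (F : fieldType) (B : lalgType F) (T : B -> B) (x : nat -> B).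

Definition prodw (w : seq nat) : B := \prod_(i <- w) x i.

(** The key (false, (u, v)) stands for x_u Tr(x_v), without the trace if v is
    empty, and (true, (u, iw)) for x_u Tr(x_i) Tr(x_w). *)
Definition nfkey := (bool * (seq nat * seq nat))%type.

Definition nf (k : nfkey) : B :=
  let: (b, (u, v)) := k in
  prodw u * (if b then T (prodw (take 1 v)) * T (prodw (behead v))
             else if v == [::] then 1 else T (prodw v)).

Definition nfword (k : nfkey) : seq nat := k.2.1 ++ k.2.2.

(** In a sorted word i :: w the letter i is the least one, which is how the
    condition i <= min w is expressed. *)
Definition nfwf (k : nfkey) : bool :=
  [&& sorted leq k.2.1, sorted leq k.2.2 & k.1 ==> (1 < size k.2.2)%N].

End NormalForm.

(** * Reduction to normal forms *)

(** The reduction is carried out in an arbitrary algebra B with a central trace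
    T, for words in elements x_0, x_1, ... of B, modulo an ideal I containing
    the needed instances of f1, f4 and f5. *)
Section Reduction.
Variables (F : fieldType) (B : lalgType F) (T : B -> B).
Hypothesis ctT : central_trace T.
Variables (x : nat -> B) (al be : F) (I : B -> Prop).
Implicit Types (p q r u v w : seq nat) (f g h : B).

Local Notation W := (prodw x).

Record relation_ideal : Prop := RelationIdeal {
  ri0 : I 0;
  riD : forall f g, I f -> I g -> I (f + g);
  riMl : forall f g, I g -> I (f * g);
  riMr : forall f g, I g -> I (g * f);
  ri_comm : forall p q, p != [::] -> q != [::] -> I (W p * W q - W q * W p);
  ri_rel4 : forall p q r, p != [::] -> q != [::] -> r != [::] ->
    I (rel4 T al be (W p) (W q) (W r));
  ri_rel5 : forall p q r, p != [::] -> q != [::] -> r != [::] ->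
    I (rel5 T al be (W p) (W q) (W r)) }.

Hypothesis rI : relation_ideal.

Lemma ideal_subspace : subspace I.
Proof.
split=> [|c f g If Ig]; first exact: ri0.
apply: riD => //; rewrite -[f]mul1r scalerAl; exact: riMl.
Qed.
Let sI := ideal_subspace.

Definition eqI f g := I (f - g).

Lemma eqI_refl f : eqI f f.
Proof. by rewrite /eqI subrr; apply: ri0. Qed.
Hint Resolve eqI_refl : core.

Lemma eqI_trans g f h : eqI f g -> eqI g h -> eqI f h.
Proof. by move=> fg gh; rewrite /eqI -(subrKA g); apply: riD. Qed.

Lemma eqI_mul f f' g g' : eqI f f' -> eqI g g' -> eqI (f * g) (f' * g').
Proof.
move=> ff gg; rewrite /eqI.
have -> : f * g - f' * g' = (f - f') * g + f' * (g - g').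
  by rewrite mulrBl mulrBr addrA subrK.
by apply: riD => //; [apply: riMr | apply: riMl].
Qed.

Lemma eqI_add f f' g g' : eqI f f' -> eqI g g' -> eqI (f + g) (f' + g').
Proof. by move=> ff gg; rewrite /eqI opprD addrACA; apply: riD. Qed.

Lemma eqI_opp f f' : eqI f f' -> eqI (- f) (- f').
Proof. by move=> ff; rewrite /eqI -opprD; apply: subspaceN. Qed.

Lemma eqI_scale c f f' : eqI f f' -> eqI (c *: f) (c *: f').
Proof. by move=> ff; rewrite /eqI -scalerBr; apply: subspaceZ. Qed.

Lemma W0 : W [::] = 1. Proof. by rewrite /prodw big_nil. Qed.

Lemma WM u v : W u * W v = W (u ++ v).
Proof. by rewrite /prodw big_cat. Qed.

Lemma trace_central f g : T f * g = g * T f.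
Proof. exact: (ct_central ctT). Qed.

Lemma word_comm p q : eqI (W p * W q) (W q * W p).
Proof.
have [->|pn] := eqVneq p [::]; first by rewrite W0 mulr1 mul1r.
have [->|qn] := eqVneq q [::]; first by rewrite W0 mulr1 mul1r.
exact: ri_comm.
Qed.

Lemma word_perm u v : perm_eq u v -> eqI (W u) (W v).
Proof.
move=> uv; apply: (@catCA_perm_ind _ (fun v => eqI (W u) (W v)) _ u v) => //.
move=> s1 s2 s3 h; apply: eqI_trans h _; rewrite -!WM !mulrA.
by apply: eqI_mul => //; apply: word_comm.
Qed.

Hypotheses (al0 : al != 0) (be0 : be != 0).

(** Exchanging q and r in f5(p, q, r) permutes all its terms modulo
    commutativity, except for D Tr(pqr); as D is invertible, letters commute
    inside traces.  The commutator f1 only acts outside the traces, as a trace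
    T-ideal need not be closed under Tr. *)
Lemma trace_swap p q r : eqI (T (W (p ++ q ++ r))) (T (W (p ++ r ++ q))).
Proof.
have TC u v : T (W (u ++ v)) = T (W (v ++ u)) by rewrite -!WM (ct_mulC ctT).
have [->|pn] := eqVneq p [::]; first by rewrite !cat0s TC.
have [->|qn] := eqVneq q [::]; first by rewrite !cats0 cat0s.
have [->|rn] := eqVneq r [::]; first by rewrite !cats0 cat0s.
have D0 : al * be != 0 by rewrite mulf_neq0.
have cancel_left f f' g g' : eqI (f + g) (f' + g') -> eqI f f' -> eqI g g'.
  move=> fg ff; rewrite /eqI; have -> : g - g' = (f + g) - (f' + g') - (f - f').
    by rewrite opprD addrACA [f - f' + _]addrC addrK.
  exact: subspaceB.
have cancel_right f f' g g' : eqI (f + g) (f' + g') -> eqI g g' -> eqI f f'.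
  by rewrite (addrC f) (addrC f'); apply: cancel_left.
have h : eqI (rel5 T al be (W p) (W q) (W r)) (rel5 T al be (W p) (W r) (W q)).
  by apply: (subspaceB sI); apply: (ri_rel5 rI).
have {h} h := cancel_right _ _ _ _ h.
have {h} := cancel_left _ _ _ _ (h _); rewrite (ct_mulC ctT (W r)) => h.
have {}h : eqI ((al * be) *: T (W p * W q * W r)) ((al * be) *: T (W p * W r * W q)).
  apply: h => //.
  rewrite (addrAC _ ((al * be) *: (W p * W r * T (W q)))
    ((al * be) *: (W p * W q * T (W r)))).
  rewrite (addrAC _ (- ((al * be) *: (W r * T (W p * W q))))
    (- ((al * be) *: (W q * T (W p * W r))))).
  rewrite -!(mulrA _ (T (W r))) (trace_central (W r)) !(mulrA _ _ (T (W r))).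
  rewrite -!(mulrA (W p)).
  do 2![apply: eqI_add => //]; apply: eqI_add => //; apply: eqI_add => //.
  apply: eqI_add; last first.
    by apply/eqI_scale/eqI_mul => //; apply: word_comm.
  do 2![apply: eqI_add => //]; apply: eqI_add => //.
  by apply/eqI_opp/eqI_scale/eqI_mul => //; apply: word_comm.
rewrite /eqI -[_ - _](scalerK D0); apply: (subspaceZ sI).
by rewrite scalerBr -!WM !mulrA.
Qed.

(** Up to rotation, every exchange of two blocks is an exchange of the last two
    of three. *)
Lemma trace_perm u v : perm_eq u v -> eqI (T (W u)) (T (W v)).
Proof.
move=> uv; apply: (@catCA_perm_ind _ (fun v => eqI (T (W u)) (T (W v))) _ u v) => //.
have TC p q : T (W (p ++ q)) = T (W (q ++ p)) by rewrite -!WM (ct_mulC ctT).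
move=> s1 s2 s3 h; apply: eqI_trans h _.
by rewrite catA TC (catA s2) (TC (s2 ++ s1)); apply: trace_swap.
Qed.

(* P plays the role of the space spanned by I and the normal forms of
   multidegree d, so membership in P means reducibility. *)
Variables (P : B -> Prop) (d : seq nat).
Hypotheses (sP : subspace P) (IP : forall f, I f -> P f)
  (nfP : forall k, nfwf k -> perm_eq (nfword k) d -> P (nf T x k)).

Lemma reduce_congr f g : eqI f g -> P g -> P f.
Proof. by move=> fg Pg; rewrite -(subrK g f); apply: subspaceD => //; apply: IP. Qed.

Lemma reduce_addl f g : P (f + g) -> P g -> P f.
Proof. by move=> Pfg Pg; rewrite -(addrK g f); apply: subspaceB. Qed.

Lemma reduce_addr f g : P (f + g) -> P f -> P g.
Proof. by rewrite addrC; apply: reduce_addl. Qed.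

Lemma reduce_word u : perm_eq u d -> P (W u).
Proof.
move=> ud; apply: (reduce_congr (word_perm (_ : perm_eq u (sort leq u)))).
  by rewrite perm_sym perm_sort.
have := @nfP (false, (sort leq u, [::])); rewrite /nf /= mulr1; apply.
  by rewrite /nfwf /= sort_sorted //; apply: leq_total.
by rewrite /nfword /= cats0 perm_sort.
Qed.

Lemma reduce_trace u v : v != [::] -> perm_eq (u ++ v) d -> P (W u * T (W v)).
Proof.
move=> vn uvd; have su w : perm_eq w (sort leq w) by rewrite perm_sym perm_sort.
apply: (reduce_congr (eqI_mul (word_perm (su u)) (trace_perm (su v)))).
have := @nfP (false, (sort leq u, sort leq v)).
rewrite /nf /= -size_eq0 size_sort size_eq0 (negPf vn); apply.
  by rewrite /nfwf /= !sort_sorted //; apply: leq_total.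
by apply: perm_trans uvd; rewrite /nfword /= perm_cat // perm_sort.
Qed.

Lemma reduce_min_trace u i v : v != [::] -> all (leq i) v -> perm_eq (u ++ i :: v) d ->
  P (W u * (T (W [:: i]) * T (W v))).
Proof.
move=> vn iv uvd; have su w : perm_eq w (sort leq w) by rewrite perm_sym perm_sort.
apply: (reduce_congr (eqI_mul (word_perm (su u)) (eqI_mul (eqI_refl _) (trace_perm (su v))))).
have := @nfP (true, (sort leq u, i :: sort leq v)); rewrite /nf /= take0; apply.
  rewrite /nfwf /= (sort_sorted leq_total) (path_sortedE leq_trans) all_sort iv.
  by rewrite (sort_sorted leq_total) ltnS size_sort lt0n size_eq0 vn.
apply: perm_trans uvd; rewrite /nfword /= perm_cat ?perm_sort //.
by rewrite perm_cons perm_sort.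
Qed.

Ltac perm_by h := let a := fresh "a" in
  apply/permP => a; rewrite -(permP h a); clear;
  do ![rewrite count_cat /=]; lia.

Lemma seq_min v : v != [::] -> exists2 i, i \in v & all (leq i) v.
Proof.
case: v => // j v _; exists (head j (sort leq (j :: v))).
  rewrite -(mem_sort leq); case e: (sort leq (j :: v)) => [|i s] /=.
    by have := size_sort leq (j :: v); rewrite e.
  by rewrite inE eqxx.
rewrite -(all_sort _ leq); have := sort_sorted leq_total (j :: v).
case e: (sort leq (j :: v)) => [|i s] //=.
by rewrite (path_sortedE leq_trans) leqnn => /andP [].
Qed.

(** Let i be the least letter in the traces; we may assume that it occurs in v,
    say v = i v'.  Solving f4(x_i, v', w) for Tr(w) Tr(x_i v') leaves a product
    of two traces without the letter i, reduced by induction on the length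
    inside the traces, terms with one trace, and products with Tr(x_i), which
    are normal because i is least. *)
Lemma reduce_two_traces u v w : v != [::] -> w != [::] -> perm_eq (u ++ v ++ w) d ->
  P (W u * (T (W v) * T (W w))).
Proof.
have [n] := ubnP (size v + size w); elim: n u v w => // n IH u v w lt vn wn uvwd.
wlog [i iv imin] : v w vn wn uvwd lt / exists2 i, i \in v & all (leq i) (v ++ w).
  move=> th; have [|i ivw imin] := @seq_min (v ++ w); first by case: (v) vn.
  have [iv|iv] := boolP (i \in v); first by apply: th => //; exists i.
  rewrite trace_central; apply: th => //.
  - by perm_by uvwd.
  - by rewrite addnC.
  - exists i; first by move: ivw; rewrite mem_cat (negPf iv).
    by rewrite all_cat andbC -all_cat.
have vi := perm_to_rem iv; set v' := rem i v in vi.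
have {}imin : all (leq i) (v' ++ w).
  by move: imin; rewrite !all_cat (perm_all _ vi) /= leqnn.
apply: reduce_congr (eqI_mul (eqI_refl _) (eqI_mul (trace_perm vi) (eqI_refl _))) _.
have [v0|v'n] := eqVneq v' [::].
  rewrite v0 in vi imin *; apply: reduce_min_trace => //.
  by rewrite -(permPr uvwd) perm_cat2l -cat1s perm_cat2r perm_sym.
have {}uvwd : perm_eq (u ++ i :: v' ++ w) d.
  by rewrite -(permPr uvwd) perm_cat2l -cat_cons perm_cat2r perm_sym.
have {}lt : (size v' + size w < n)%N by move: lt; rewrite (perm_size vi) /=; lia.
have := IP (riMl rI (W u) (ri_rel4 rI (isT : [:: i] != [::]) v'n wn)).
rewrite /rel4 !WM !mulrDr -!scalerN !(mulrN, (ct_scalerAr ctT)) -!mulrA.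
rewrite (trace_central (W w) (T (W ([:: i] ++ v')))).
rewrite !(mulrA (W u) (W _)) !WM => h.
(* Everything in h but its last term, x_u Tr(x_i v') Tr(w), is reducible. *)
apply: reduce_addr h _;
  do ![apply: subspaceD => // | apply: subspaceZ => // | apply: subspaceN => //].
- by apply: IH => //; perm_by uvwd.
- apply: reduce_trace; [by case: (v') v'n | by perm_by uvwd].
- apply: reduce_min_trace => //; last by perm_by uvwd.
  by move: imin; rewrite all_cat => /andP [].
- by apply: reduce_trace => //; perm_by uvwd.
- apply: reduce_min_trace; [by case: (v') v'n | by [] | by perm_by uvwd].
Qed.

(** Induction on the number of traces: f5 replaces a product of three traces by
    terms with at most two, the remaining traces M being carried along. *)
Lemma reduce_traces u L : all (fun v => v != [::]) L -> perm_eq (u ++ flatten L) d ->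
  P (W u * \prod_(v <- L) T (W v)).
Proof.
have [n] := ubnP (size L); elim: n u L => // n IH u L lt.
case: L lt => [|p [|q [|r L]]] lt.
- by rewrite big_nil mulr1 cats0 => _; apply: reduce_word.
- by rewrite big_seq1 /= andbT cats0; apply: reduce_trace.
- rewrite !big_cons big_nil mulr1 /= andbT cats0 => /andP []; exact: reduce_two_traces.
move=> /= /and4P [pn qn rn Ln] uLd.
have catn (v w : seq nat) : v != [::] -> v ++ w != [::] by case: v.
set M := \prod_(v <- L) T (W v).
have P0 u' : perm_eq (u' ++ flatten L) d -> P (W u' * M).
  by move=> u'd; apply: IH => //; move: lt => /=; lia.
have P1 u' v : v != [::] -> perm_eq (u' ++ v ++ flatten L) d -> P (W u' * (T (W v) * M)).
  move=> vn u'd; have := IH u' (v :: L); rewrite big_cons /= vn; apply => //.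
  by move: lt => /=; lia.
have P2 u' v w : v != [::] -> w != [::] -> perm_eq (u' ++ v ++ w ++ flatten L) d ->
    P (W u' * (T (W v) * (T (W w) * M))).
  move=> vn wn u'd; have := IH u' [:: v, w & L]; rewrite !big_cons /= vn wn; apply => //.
have := IP (riMl rI (W u) (riMr rI M (ri_rel5 rI pn qn rn))).
rewrite /rel5 !WM !mulrDl !mulrDr -!scalerN -!scalerAl !(mulNr, mulrN, (ct_scalerAr ctT)).
rewrite -!mulrA !(mulrA (W u) (W _)) !WM => h.
rewrite !big_cons -/M.
(* Only the leading term Tr(p) Tr(q) Tr(r) of f5 is left once the other ten
   have been discharged. *)
apply: (reduce_addl (reduce_addl (reduce_addl (reduce_addl (reduce_addl
  (reduce_addl (reduce_addl (reduce_addl (reduce_addl (reduce_addl h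
  _) _) _) _) _) _) _) _) _) _);
  do ?[apply: subspaceZ => // | apply: subspaceN => //].
- by apply: P2 => //; [exact: catn | perm_by uLd].
- by apply: P1; [case: (p) pn | perm_by uLd].
- by apply: P1; [exact: catn | perm_by uLd].
- by apply: P1; [exact: catn | perm_by uLd].
- by apply: P1; [exact: catn | perm_by uLd].
- by apply: P2 => //; perm_by uLd.
- by apply: P1 => //; perm_by uLd.
- by apply: P1 => //; perm_by uLd.
- by apply: P1 => //; perm_by uLd.
- by apply: P0; perm_by uLd.
Qed.

Lemma reduce_tev (m : tmonom) : (forall i, occ i m = count_mem i d) -> P (tev T x m).
Proof.
move=> om; have cT (c : cycword) : central (T (W (val (repr c)))) by apply: (ct_central ctT).
rewrite /tev (central_prod _ cT).
have := @reduce_traces m.2 [seq val (repr c) | c <- cmseq m.1]; rewrite big_map; apply.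
  by apply/allP => w /mapP [c _ ->]; exact: (valP (repr c)).
apply: perm_count_mem => i; rewrite -om /occ -sum_cmseq count_cat addnC.
by rewrite count_flatten -map_comp sumnE big_map.
Qed.

End Reduction.

(** * Independence of normal forms *)

Section Characters.
Variables (F : fieldType) (M : Type) (E : eqType) (mulM : M -> M -> M) (oneM : M).
Variable chi : E -> M -> F.
Hypotheses (chiM : forall e x y, chi e (mulM x y) = chi e x * chi e y)
  (chi1 : forall e, chi e oneM = 1).

(** Artin's lemma: comparing the relation at the product x y with chi_0(y) times
    the relation at x eliminates the character chi_0. *)
Lemma characters_free (s : seq E) (c : E -> F) : uniq s ->
  {in s &, forall e e', e != e' -> exists y, chi e y != chi e' y} ->
  (forall x, \sum_(e <- s) c e * chi e x = 0) -> {in s, forall e, c e = 0}.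
Proof.
elim: s c => [//|e0 s IH] c /= /andP [e0s us] dist c0 e.
have cs : {in s, forall e, c e = 0}.
  move=> {}e es; have [y] : exists y, chi e y != chi e0 y.
    apply: dist; rewrite ?inE ?eqxx ?es ?orbT //.
    by apply: contraNneq e0s => <-.
  rewrite -subr_eq0 => dy; apply: (mulIf dy); rewrite mul0r.
  apply: (IH (fun e => c e * (chi e y - chi e0 y))) es => // [e1 e2 s1 s2|x].
    by apply: dist; rewrite inE ?s1 ?s2 orbT.
  have := c0 (mulM x y); have := c0 x; rewrite !big_cons => /eqP.
  rewrite addr_eq0 => /eqP h1; rewrite chiM mulrA h1 mulNr => /eqP.
  rewrite addrC subr_eq0 => /eqP h2.
  under eq_bigr do rewrite mulrBr mulrBl.
  rewrite sumrB; apply/eqP; rewrite subr_eq0; apply/eqP.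
  transitivity (\sum_(e <- s) c e * chi e (mulM x y)).
    by apply: eq_bigr => e1 _; rewrite chiM mulrA mulrAC.
  by rewrite h2 mulr_suml; apply: eq_bigr => e1 _; rewrite mulrAC.
rewrite inE => /predU1P [->|/cs //].
have := c0 oneM; rewrite big_cons chi1 mulr1 big_seq big1 ?addr0 // => e1 /cs ->.
by rewrite mul0r.
Qed.

End Characters.

Section MonomialCharacters.
Variable F : fieldType.
Hypothesis charF0 : [pchar F] =i pred0.
Implicit Types (u v : seq nat) (a b : nat -> F).

Definition wprod a u : F := \prod_(i <- u) a i.

(** Bimonomials a_u b_v, multiplicative in the point (a, b). *)
Definition bimon (e : seq nat * seq nat) a b : F := wprod a e.1 * wprod b e.2.

Lemma expn2_inj (m n : nat) : (2%:R : F) ^+ m = 2%:R ^+ n -> m = n.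
Proof.
wlog le : m n / (m <= n)%N => [th|].
  by have [/th //|/ltnW /th h /esym /h ->] := leqP m n.
move=> /eqP; rewrite eq_sym -!natrX -subr_eq0 -natrB ?leq_exp2l // ((pcharf0P F).1 charF0).
by rewrite subn_eq0 leq_exp2l // => nm; apply/eqP; rewrite eqn_leq le.
Qed.

Lemma wprod_at2 u i : wprod (fun j => if j == i then 2%:R else 1) u = 2%:R ^+ count_mem i u.
Proof.
rewrite /wprod -big_mkcond /= big_const_seq iter_mulr_1.
by congr (_ ^+ _); apply: eq_count.
Qed.

Lemma wprod_one u : wprod (fun=> 1) u = 1.
Proof. by rewrite /wprod big1. Qed.

Lemma sorted_count_neq u v : sorted leq u -> sorted leq v -> u != v ->
  exists i, count_mem i u != count_mem i v.
Proof.
move=> su sv uv.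
have [/hasP [i _ ne]|/hasPn eq] :=
  boolP (has (fun i => count_mem i u != count_mem i v) (u ++ v)); first by exists i.
case/eqP: uv; apply: (sorted_eq leq_trans anti_leq su sv).
by apply/allP => i /eq; rewrite negbK.
Qed.

(** Sorted words that differ have some letter i with different multiplicities,
    and the point with a_i = 2 (or b_i = 2) and all other coordinates 1 tells
    the powers of 2 apart. *)
Lemma bimon_neq e e' : sorted leq e.1 -> sorted leq e.2 ->
  sorted leq e'.1 -> sorted leq e'.2 -> e != e' ->
  exists y : (nat -> F) * (nat -> F), bimon e y.1 y.2 != bimon e' y.1 y.2.
Proof.
case: e e' => [u v] [u' v'] /= su sv su' sv'; rewrite xpair_eqE negb_and.
case/orP => /sorted_count_neq - /(_ _ _) [] // i ne.
  exists (fun j => if j == i then 2%:R else 1, fun=> 1).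
  rewrite /bimon /= !wprod_at2 !wprod_one !mulr1.
  by apply: contraNneq ne => /expn2_inj ->.
exists (fun=> 1, fun j => if j == i then 2%:R else 1).
rewrite /bimon /= !wprod_at2 !wprod_one !mul1r.
by apply: contraNneq ne => /expn2_inj ->.
Qed.

Lemma bimon_free (s : seq (seq nat * seq nat)) (c : seq nat * seq nat -> F) :
  uniq s -> {in s, forall e, sorted leq e.1 && sorted leq e.2} ->
  (forall a b, \sum_(e <- s) c e * bimon e a b = 0) -> {in s, forall e, c e = 0}.
Proof.
move=> us ss c0; apply: (characters_free
  (mulM := fun x y : (nat -> F) * (nat -> F) => (fun i => x.1 i * y.1 i, fun i => x.2 i * y.2 i))
  (oneM := (fun=> 1, fun=> 1)) (chi := fun e y => bimon e y.1 y.2)) => //.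
- by move=> e y z; rewrite /bimon /wprod !big_split /= mulrACA.
- by move=> e; rewrite /bimon /= !wprod_one mulr1.
- by move=> e e' /ss /andP [? ?] /ss /andP [? ?]; apply: bimon_neq.
Qed.

(** In a vanishing combination listed with repetitions, the coefficients of
    equal bimonomials add up to 0. *)
Lemma bimon_free_collect (L : seq (F * (seq nat * seq nat))) e :
  {in L, forall p, sorted leq p.2.1 && sorted leq p.2.2} ->
  (forall a b, \sum_(p <- L) p.1 * bimon p.2 a b = 0) ->
  \sum_(p <- L) p.1 * (p.2 == e)%:R = 0.
Proof.
move=> Ls L0; pose s := undup [seq p.2 | p <- L].
have us : uniq s by apply: undup_uniq.
pose c e := \sum_(p <- L) p.1 * (p.2 == e)%:R.
have cs : {in s, forall e, c e = 0}.
  apply: bimon_free => // [e'|a b]; first by rewrite mem_undup => /mapP [p /Ls pL ->].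
  rewrite -[RHS](L0 a b) /c; under eq_bigr do rewrite mulr_suml.
  rewrite exchange_big /=; apply: eq_big_seq => p pL.
  rewrite (bigD1_seq p.2) //= ?mem_undup ?map_f // eqxx mulr1.
  by rewrite big1 ?addr0 // => e' /negPf ne; rewrite eq_sym ne mulr0 mul0r.
have [/cs //|es] := boolP (e \in s).
rewrite big_seq big1 // => p pL; case: eqP => [pe|]; last by rewrite mulr0.
by case/negP: es; rewrite mem_undup -pe map_f.
Qed.

End MonomialCharacters.

Section Coefficients.
Variables (F : fieldType) (al be : F).
Implicit Types (u v : seq nat) (a b : nat -> F).

(** The first component of a normal form on the diagonal matrices with entries
    (a_i, b_i); the second component is obtained by exchanging alpha with beta
    and a with b. *)
Definition nfval a b (k : nfkey) : F :=
  let t v := al * wprod a v + be * wprod b v in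
  let: (c, (u, v)) := k in
  wprod a u * (if c then t (take 1 v) * t (behead v)
               else if v == [::] then 1 else t v).

Lemma eq_nfval a a' b b' k : a =1 a' -> b =1 b' -> nfval a b k = nfval a' b' k.
Proof.
move=> ea eb; have Wa u : wprod a u = wprod a' u by apply: eq_bigr => i _; apply: ea.
have Wb u : wprod b u = wprod b' u by apply: eq_bigr => i _; apply: eb.
by case: k => [c [u v]]; rewrite /nfval !Wa !Wb.
Qed.

Local Notation so := (sort leq).

(** The expansion of [nfval] in bimonomials, with sorted words. *)
Definition nfpoly (k : nfkey) : seq (F * (seq nat * seq nat)) :=
  let: (c, (u, v)) := k in
  if c then [:: (al ^+ 2, (so (u ++ v), [::]));
                (al * be, (so (u ++ take 1 v), behead v));
                (al * be, (so (u ++ behead v), take 1 v));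
                (be ^+ 2, (u, v))]
  else if v == [::] then [:: (1, (u, v))]
  else [:: (al, (so (u ++ v), [::])); (be, (u, v))].

Lemma wprod_sort a u : wprod a (so u) = wprod a u.
Proof. by apply: perm_big; rewrite perm_sort. Qed.

Lemma wprod_cat a u v : wprod a (u ++ v) = wprod a u * wprod a v.
Proof. exact: big_cat. Qed.

Lemma wprod0 a : wprod a [::] = 1. Proof. exact: big_nil. Qed.

Lemma nfpolyE a b k : \sum_(p <- nfpoly k) p.1 * bimon p.2 a b = nfval a b k.
Proof.
case: k => [[] [u v]]; rewrite /nfpoly /nfval.
  have vE (c : nat -> F) : wprod c v = wprod c (take 1 v) * wprod c (behead v).
    by rewrite -wprod_cat -drop1 cat_take_drop.
  rewrite !big_cons big_nil /bimon /= !wprod_sort !wprod_cat wprod0 !vE; ring.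
have [->|_] := eqVneq v [::]; first by rewrite big_seq1 /bimon mul1r !wprod0.
by rewrite !big_cons big_nil /bimon /= !wprod_sort wprod_cat wprod0; ring.
Qed.

Lemma nfpoly_sorted k : nfwf k ->
  {in nfpoly k, forall p, sorted leq p.2.1 && sorted leq p.2.2}.
Proof.
case: k => [c [u v]] /and3P [/= su sv _] p; have st := sort_sorted leq_total.
have s1 : sorted leq (take 1 v) by case: (v) => [|i w] //=; rewrite take0.
have sb : sorted leq (behead v) by case: (v) sv => //= i w; apply: path_sorted.
rewrite /nfpoly; case: c; last case: ifP => _; rewrite !inE.
- by case/or4P => /eqP -> /=; rewrite ?st ?su ?sv ?s1 ?sb.
- by move=> /eqP -> /=; rewrite su sv.
- by case/orP => /eqP -> /=; rewrite ?st ?su ?sv.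
Qed.

Definition coefp (k : nfkey) e : F := \sum_(p <- nfpoly k) p.1 * (p.2 == e)%:R.

(** The key of x_u Tr(x_i) Tr(x_w) contributes D a_{ui} b_w; this is the index
    (ui, w) of that bimonomial. *)
Definition shift (k : nfkey) := (so (k.2.1 ++ take 1 k.2.2), behead k.2.2).

(** Only three sorts of terms of [nfpoly] can carry a bimonomial a_u b_v with v
    of length at least 2, the others having at most one b. *)
Lemma coefp_two_letters k u v : nfwf k -> (1 < size v)%N ->
  coefp k (u, v) = be * (k == (false, (u, v)))%:R + be ^+ 2 * (k == (true, (u, v)))%:R
    + al * be * (k.1 && (shift k == (u, v)))%:R.
Proof.
case: k => [c [u' v']] /and3P [_ _ /= sv'] sv; rewrite /coefp /nfpoly /shift /=.
have n0 : ([::] == v) = false by case: (v) sv.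
case: c sv' => /= sv'.
  rewrite !big_cons big_nil !xpair_eqE n0 !andbF /=.
  have -> : (take 1 v' == v) = false.
    by apply: contraTF sv => /eqP <-; rewrite size_take; case: ifP; lia.
  by rewrite andbF /=; ring.
have [->|_] := eqVneq v' [::]; rewrite !big_cons big_nil !xpair_eqE n0 !andbF /=; ring.
Qed.

Variables (ks : seq nfkey) (c : nfkey -> F).
Hypotheses (uks : uniq ks) (wks : {in ks, forall k, nfwf k})
  (cks : forall k, k \notin ks -> c k = 0) (charF0 : [pchar F] =i pred0).
Hypothesis val0 : forall a b, \sum_(k <- ks) c k * nfval a b k = 0.

Lemma coefp_sum0 e : \sum_(k <- ks) c k * coefp k e = 0.
Proof.
pose L := [seq (c k * p.1, p.2) | k <- ks, p <- nfpoly k].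
have := @bimon_free_collect F charF0 L e.
rewrite /L !big_allpairs_dep /=; under eq_bigr do under eq_bigr do rewrite -mulrA.
under eq_bigr do rewrite -mulr_sumr; apply.
  by move=> p /allpairsPdep [k [q [/wks kw kq ->]]]; apply: nfpoly_sorted kq.
move=> a b; rewrite big_allpairs_dep /= -[RHS](val0 a b).
apply: eq_bigr => k _; rewrite -nfpolyE mulr_sumr.
by apply: eq_bigr => p _; rewrite mulrA.
Qed.

Lemma sum_key k0 : \sum_(k <- ks) c k * (k == k0)%:R = c k0.
Proof.
have [k0s|/[dup] k0s /cks ->] := boolP (k0 \in ks).
  rewrite (bigD1_seq k0) //= eqxx mulr1 big1 ?addr0 // => k /negPf ->.
  by rewrite mulr0.
by rewrite big_seq big1 // => k ks_; case: eqP k0s => [<-|]; rewrite ?ks_ ?mulr0.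
Qed.

Definition shift_sum e := \sum_(k <- ks) c k * (k.1 && (shift k == e))%:R.

Lemma coef_relation u v : (1 < size v)%N ->
  be * c (false, (u, v)) + be ^+ 2 * c (true, (u, v)) + al * be * shift_sum (u, v) = 0.
Proof.
move=> sv; rewrite -[RHS](coefp_sum0 (u, v)).
have -> : \sum_(k <- ks) c k * coefp k (u, v) = \sum_(k <- ks)
   (be * (c k * (k == (false, (u, v)))%:R) + be ^+ 2 * (c k * (k == (true, (u, v)))%:R)
    + al * be * (c k * (k.1 && (shift k == (u, v)))%:R)).
  by apply: eq_big_seq => k /wks kw; rewrite coefp_two_letters //; ring.
by rewrite !big_split /= -!mulr_sumr !sum_key.
Qed.

Lemma coef_false_trace_eq0 : (forall k : nfkey, k.1 -> c k = 0) ->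
  forall u v, v != [::] -> be * c (false, (u, v)) = 0.
Proof.
move=> c1 u v vn; rewrite -sum_key mulr_sumr -[RHS](coefp_sum0 (u, v)).
apply: eq_bigr => -[[] [u' v']] _; first by rewrite c1 // !mul0r mulr0.
rewrite /coefp /nfpoly; have n0 : ([::] == v) = false by rewrite eq_sym (negPf vn).
have [->|_] := eqVneq v' [::]; rewrite !big_cons big_nil !xpair_eqE n0 !andbF /=; ring.
Qed.

(** Once the coefficients of the normal forms with traces are 0, those of the
    pure words are read off from the bimonomials in a alone. *)
Lemma coef_eq0_of_traceless :
  (forall k : nfkey, k.1 || (k.2.2 != [::]) -> c k = 0) -> forall k, c k = 0.
Proof.
move=> c1 [c' [u v]].
have [h|/norP [/= /negPf -> /negPn/eqP ->]] := boolP (c' || (v != [::])); first exact: c1.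
rewrite -sum_key -[RHS](coefp_sum0 (u, [::])); apply: eq_bigr => -[b [u' v']] _.
have [h|/norP [/= /negPf -> /negPn/eqP ->]] := boolP (b || (v' != [::])).
  by rewrite c1 // !mul0r.
by rewrite /coefp /nfpoly /= big_seq1 mul1r.
Qed.

End Coefficients.

Section Independence.
Variables (F : fieldType) (al be : F) (ks : seq nfkey) (c : nfkey -> F).
Hypotheses (al0 : al != 0) (be0 : be != 0) (albe : al != be).
Hypotheses (uks : uniq ks) (wks : {in ks, forall k, nfwf k})
  (cks : forall k, k \notin ks -> c k = 0) (charF0 : [pchar F] =i pred0).
Hypotheses (val1 : forall a b, \sum_(k <- ks) c k * nfval al be a b k = 0)
  (val2 : forall a b, \sum_(k <- ks) c k * nfval be al b a k = 0).

Let val2' a b : \sum_(k <- ks) c k * nfval be al a b k = 0.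
Proof. exact: val2. Qed.

(** The equations coming from the two components, divided by beta and by alpha,
    differ by (alpha - beta) times the difference of the two sides. *)
Lemma coef_shift u v : (1 < size v)%N -> c (true, (u, v)) = shift_sum ks c (u, v).
Proof.
move=> sv; have e1 := coef_relation uks wks cks charF0 val1 u sv.
have e2 := coef_relation uks wks cks charF0 val2' u sv.
set x := c (false, _) in e1 e2; set y := c _ in e1 e2 *; set z := shift_sum _ _ _ in e1 e2 *.
have {}e1 : x + be * y + al * z = 0 by apply: (mulfI be0); rewrite mulr0 -[RHS]e1; ring.
have {}e2 : x + al * y + be * z = 0 by apply: (mulfI al0); rewrite mulr0 -[RHS]e2; ring.
have d : al - be != 0 by rewrite subr_eq0.
apply: (mulfI d); apply/eqP; rewrite -subr_eq0; apply/eqP.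
by rewrite -[RHS](subrr 0) -{1}e2 -e1; ring.
Qed.

(** The keys contributing to [shift_sum] at (u, v) have a first word one letter
    shorter than u, so the recursion of [coef_shift] terminates at 0. *)
Lemma coef_true0 u v : c (true, (u, v)) = 0.
Proof.
have [n] := ubnP (size u); elim: n u v => // n IH u v lt.
have [kk|/cks //] := boolP ((true, (u, v)) \in ks).
have /and3P [_ _ /= sv] := wks kk; rewrite coef_shift //.
rewrite /shift_sum big_seq big1 // => -[b [u' v']] k'k /=.
have [/andP [bT /eqP [eu ev]]|_] := boolP (b && _); last by rewrite mulr0.
rewrite bT IH ?mul0r //; rewrite ltnS in lt; apply: leq_trans lt.
rewrite -eu size_sort size_cat.
have /and3P [_ _ /=] := wks k'k; rewrite bT /=; case: (v') => //= i w.
by rewrite take0 addn1.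
Qed.

Lemma nfval_free k : c k = 0.
Proof.
have c1 (k' : nfkey) : k'.1 -> c k' = 0 by case: k' => [[] [u v]] // _; apply: coef_true0.
apply: (coef_eq0_of_traceless uks wks cks charF0 val1) => {}k; case/orP; first exact: c1.
case: k => [[] [u v]] /= vn; first exact: c1.
by apply: (mulfI be0); rewrite mulr0; apply: (coef_false_trace_eq0 uks wks cks charF0 val1).
Qed.

End Independence.

(** * Normal forms in the free algebra with trace *)

Section Spans.
Variables (F : fieldType) (V : lmodType F) (I : V -> Prop).
Hypothesis sI : subspace I.

Lemma subspace_lext (K : choiceType) (g : K -> V) (wf : pred K) :
  subspace (fun f => exists h : {malg F[K]},
    (forall k, k \in msupp h -> wf k) /\ I (f - lext g h)).
Proof.
split; first by exists 0; split; [move=> k; rewrite msupp0 | rewrite linear0 subrr; apply: sI.1].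
move=> c u v [hu [wu Iu]] [hv [wv Iv]]; exists (c *: hu + hv); split=> [k|].
  move/(fsubsetP (msuppD_le _ _)); rewrite inE => /orP [|/wv //].
  by move/(fsubsetP (msuppZ_le _ _))/wu.
have -> : c *: u + v - lext g (c *: hu + hv) = c *: (u - lext g hu) + (v - lext g hv).
  by rewrite lext_linear scalerBr opprD addrACA.
exact: sI.2.
Qed.

Lemma subspace_comb (d : nat) (b : 'I_d -> V) :
  subspace (fun f => exists c : 'I_d -> F, I (f - \sum_i c i *: b i)).
Proof.
split.
  exists (fun=> 0); rewrite big1 ?subr0; first exact: sI.1.
  by move=> i _; rewrite scale0r.
move=> c u v [cu Iu] [cv Iv]; exists (fun i => c * cu i + cv i).
have -> : c *: u + v - \sum_i (c * cu i + cv i) *: b i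
    = c *: (u - \sum_i cu i *: b i) + (v - \sum_i cv i *: b i).
  rewrite scalerBr addrACA -opprD scaler_sumr -big_split /=.
  by congr (_ - _); apply: eq_bigr => i _; rewrite scalerDl scalerA.
exact: sI.2.
Qed.

End Spans.

Section FreeNormalForms.
Variable F : fieldType.

Definition nff : nfkey -> {freetr F} := nf (@Tr F) (letter F).

Lemma prodw_letter w : prodw (letter F) w = X F w.
Proof.
elim: w => [|i w IH]; first by rewrite /prodw big_nil X0.
by rewrite /prodw big_cons -/(prodw _ w) IH X_letter XM.
Qed.

Lemma mon_tev m : mon F m = tev (@Tr F) (letter F) m.
Proof.
rewrite mon_decomp /tev -prodw_letter; congr (_ * _).
by apply: eq_bigr => c _; rewrite -Tr_X -prodw_letter.
Qed.

Lemma proper_prodw (g : nat -> {freetr F}) w :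
  (forall i, proper (g i)) -> w != [::] -> proper (prodw g w).
Proof. by move=> pg wn; apply: proper_prod. Qed.

Lemma nff_mon k : nfwf k ->
  exists m, nff k = mon F m /\ forall i, occ i m = count_mem i (nfword k).
Proof.
have WE w : exists m, X F w = mon F m /\ forall i, occ i m = count_mem i w.
  by exists (word w); split => // i; rewrite occ_word.
have TE w : w != [::] -> exists m, Tr (X F w) = mon F m /\ forall i, occ i m = count_mem i w.
  move=> wn; eexists; split; first by rewrite Tr_X (Tr_word_nz F wn).
  by move=> i; rewrite occ_trmon.
case: k => [b [u v]] /and3P [_ _ /= bv]; rewrite /nff /nf !prodw_letter /nfword /=.
have [mu [-> ou]] := WE u.
case: b bv => /= [sv|_].
  have [|m1 [-> o1]] := TE (take 1 v); first by case: (v) sv.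
  have [|m2 [-> o2]] := TE (behead v); first by case: (v) sv => [|i [|j w]].
  rewrite !monM; eexists; split; first by [].
  by move=> i; rewrite !occM ou o1 o2 -count_cat -drop1 cat_take_drop count_cat.
case: eqVneq => [->|vn]; first by rewrite mulr1; exists mu; rewrite cats0.
have [mv [-> ov]] := TE v vn; rewrite monM; eexists; split; first by [].
by move=> i; rewrite occM ou ov count_cat.
Qed.

(** The substitutions x_1, x_2, x_3 |-> p, q, r by nonempty words are proper. *)
Lemma freetr_relation_ideal (al be : F) (I : {freetr F} -> Prop) :
  trace_T_ideal I -> I (f1 F) -> I (f4 al be) -> I (f5 al be) ->
  relation_ideal (@Tr F) (letter F) al be I.
Proof.
move=> tI If1 If4 If5; have ct := central_trace_Tr F.
pose s p q r i : {freetr F} := nth (prodw (letter F) p)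
  [:: prodw (letter F) p; prodw (letter F) q; prodw (letter F) r] i.
have ps p q r : p != [::] -> q != [::] -> r != [::] -> forall i, proper (s p q r i).
  move=> pn qn rn; have pl := proper_prodw (@proper_letter F).
  by case=> [|[|[|i]]]; rewrite /s /= ?nth_nil; apply: pl.
split.
- exact: tT_zero.
- exact: tT_add.
- exact: tT_mull.
- by move=> f g; apply: tT_mulr.
- move=> p q pn qn; have := tT_subst tI (ps p q q pn qn qn) If1.
  by rewrite /tsubst teval_f1.
- move=> p q r pn qn rn; have := tT_subst tI (ps p q r pn qn rn) If4.
  by rewrite /tsubst teval_f4.
- move=> p q r pn qn rn; have := tT_subst tI (ps p q r pn qn rn) If5.
  by rewrite /tsubst teval_f5.
Qed.

Variables (B : lalgType F) (T : B -> B).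
Hypothesis ctT : central_trace T.

Lemma teval_nff a k : nfwf k -> teval T a (nff k) = nf T a k.
Proof.
have W w : teval_to T a (prodw (letter F) w) (prodw a w).
  rewrite /teval_to /prodw teval_prod //; apply: eq_bigr => i _; exact: teval_letter.
have TW w : w != [::] -> teval_to T a (Tr (prodw (letter F) w)) (T (prodw a w)).
  by move=> wn; apply: teval_to_Tr => //; apply: proper_prodw => //; apply: proper_letter.
case: k => [b [u v]] /and3P [_ _ /= bv]; apply: (teval_toM ctT (W u)).
case: b bv => /= [sv|_].
  apply: (teval_toM ctT); apply: TW; first by case: (v) sv.
  by case: (v) sv => [|i [|j w]].
by case: eqVneq => [_|vn]; [apply: teval1 | apply: TW].
Qed.

End FreeNormalForms.

(** * Evaluation on diagonal matrices *)

Section Components.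
Variables (F : fieldType) (B : lalgType F) (T : B -> B) (al be : F).
Variable c : 'I_2 -> B -> F.
Hypotheses (cD : forall j x y, c j (x + y) = c j x + c j y)
  (cN : forall j x, c j (- x) = - c j x) (cM : forall j x y, c j (x * y) = c j x * c j y)
  (cZ : forall j k x, c j (k *: x) = k * c j x)
  (cT : forall j x, c j (T x) = al * c 0 x + be * c 1 x).
Lemma ord2 (j : 'I_2) : j = 0 \/ j = 1.
Proof. by case: j => [[|[|j]] jlt] //; [left | right]; apply: val_inj. Qed.

Lemma comp_rel4 j x y z : c j (rel4 T al be x y z) = 0.
Proof.
rewrite /rel4 !(cD, cN, cM, cZ, cT); case: (ord2 j) => ->;
move: (c 0 x) (c 0 y) (c 0 z) (c 1 x) (c 1 y) (c 1 z) => *; ring.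
Qed.

Lemma comp_rel5 j x y z : c j (rel5 T al be x y z) = 0.
Proof.
rewrite /rel5 !(cD, cN, cM, cZ, cT); case: (ord2 j) => ->;
move: (c 0 x) (c 0 y) (c 0 z) (c 1 x) (c 1 y) (c 1 z) => *; ring.
Qed.

End Components.

Section DiagonalComponents.
Variables (F : fieldType) (al be : F).
Implicit Types x y : D2 F.

Definition comp (j : 'I_2) x : F := val x j j.

Lemma D2_offdiag x (i j : 'I_2) : i != j -> val x i j = 0.
Proof. by move=> ij; have /is_diag_mxP := valP x; apply. Qed.

Lemma D2_eq x y : (forall j, comp j x = comp j y) -> x = y.
Proof.
move=> e; apply: val_inj; apply/matrixP => i j.
by have [<-|ij] := eqVneq i j; [apply: e | rewrite !D2_offdiag].
Qed.

Lemma compM j x y : comp j (x * y) = comp j x * comp j y.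
Proof.
rewrite /comp (_ : val (x * y) = val x *m val y) // mxE (bigD1 j) //=.
by rewrite big1 ?addr0 // => i ij; rewrite D2_offdiag ?mul0r // eq_sym.
Qed.

Lemma compD j x y : comp j (x + y) = comp j x + comp j y.
Proof. by rewrite /comp (_ : val (x + y) = val x + val y) // mxE. Qed.

Lemma compN j x : comp j (- x) = - comp j x.
Proof. by rewrite /comp (_ : val (- x) = - val x) // mxE. Qed.

Lemma compZ j c x : comp j (c *: x) = c * comp j x.
Proof. by rewrite /comp (_ : val (c *: x) = c *: val x) // mxE. Qed.

Lemma comp1 j : comp j 1 = 1.
Proof. by rewrite /comp (_ : val (1 : D2 F) = 1%:M) // mxE eqxx. Qed.

Lemma comp0 j : comp j 0 = 0.
Proof. by rewrite /comp (_ : val (0 : D2 F) = 0) // mxE. Qed.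

Definition tD2 x : D2 F := (t_trace al be x)%:A.

Lemma compT j x : comp j (tD2 x) = al * comp 0 x + be * comp 1 x.
Proof. by rewrite /tD2 compZ comp1 mulr1. Qed.

Definition compE := (compD, compN, compZ, compM, compT, comp0, comp1).

Lemma comp_prodw j (a : nat -> D2 F) w :
  comp j (prodw a w) = wprod (fun i => comp j (a i)) w.
Proof.
elim: w => [|i w IH]; first by rewrite /prodw /wprod !big_nil comp1.
by rewrite /prodw /wprod !big_cons compM -/(prodw a w) IH.
Qed.

Lemma comp_sum j (K : Type) (ks : seq K) (g : K -> D2 F) :
  comp j (\sum_(k <- ks) g k) = \sum_(k <- ks) comp j (g k).
Proof. exact: (big_morph _ (compD j) (comp0 j)). Qed.

Definition diag2 (p q : F) : 'M[F]_2 := diag_mx (\row_j if j == 0 then p else q).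

Lemma diag2P p q : diag2 p q \in @diag_pred F.
Proof. exact: diag_mx_is_diag. Qed.

Definition D2_of p q : D2 F := Sub (diag2 p q) (diag2P p q).

Lemma comp_D2_of p q : comp 0 (D2_of p q) = p /\ comp 1 (D2_of p q) = q.
Proof. by rewrite /comp /= !mxE. Qed.

Let ct : central_trace tD2 := central_trace_scalar (t_trace al be).

Lemma Id_f1 : Id_tr (t_trace al be) (f1 F).
Proof. by move=> a; rewrite (teval_f1 ct); apply: D2_eq => j; rewrite !compE; ring. Qed.

Lemma Id_f4 : Id_tr (t_trace al be) (f4 al be).
Proof.
move=> a; rewrite (teval_f4 ct); apply: D2_eq => j; rewrite comp0.
exact: (comp_rel4 compD compN compM compZ compT).
Qed.

Lemma Id_f5 : Id_tr (t_trace al be) (f5 al be).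
Proof.
move=> a; rewrite (teval_f5 ct); apply: D2_eq => j; rewrite comp0.
exact: (comp_rel5 compD compN compM compZ compT).
Qed.

Lemma comp_nf0 a k :
  comp 0 (nf tD2 a k) = nfval al be (fun i => comp 0 (a i)) (fun i => comp 1 (a i)) k.
Proof.
case: k => [[] [u v]]; rewrite /nf /nfval !compE !comp_prodw //.
by case: eqVneq; rewrite ?compE ?comp_prodw.
Qed.

Lemma comp_nf1 a k :
  comp 1 (nf tD2 a k) = nfval be al (fun i => comp 1 (a i)) (fun i => comp 0 (a i)) k.
Proof.
case: k => [[] [u v]]; rewrite /nf /nfval !compE !comp_prodw.
  by rewrite !(addrC (be * _)).
by case: eqVneq; rewrite ?compE ?comp_prodw // addrC.
Qed.

Hypotheses (charF0 : [pchar F] =i pred0) (al0 : al != 0) (be0 : be != 0) (albe : al != be).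

(** The evaluation on diag(a_i, b_i) has the two components to which
    [nfval_free] applies. *)
Lemma Id_nff_free (ks : seq nfkey) (c : nfkey -> F) : uniq ks ->
  {in ks, forall k, nfwf k} -> (forall k, k \notin ks -> c k = 0) ->
  Id_tr (t_trace al be) (\sum_(k <- ks) c k *: nff F k) -> forall k, c k = 0.
Proof.
move=> uks wks cks Id0.
have ev a : \sum_(k <- ks) c k *: nf tD2 a k = 0.
  rewrite -[RHS](Id0 a); apply/esym.
  have st : {subset ks <= ks} by [].
  elim: {1 3 4}ks st => [|k s IH] st; first by rewrite !big_nil; apply: linear0.
  rewrite !big_cons; apply: teval_toD; last by apply: IH => i si; apply: st; rewrite inE si orbT.
  by apply: teval_toZ; apply: (teval_nff ct); apply/wks/st; rewrite inE eqxx.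
have cp (a b : nat -> F) i := comp_D2_of (a i) (b i).
apply: (nfval_free al0 be0 albe uks wks cks charF0) => a b.
  have := congr1 (comp 0) (ev (fun i => D2_of (a i) (b i))).
  rewrite comp_sum comp0 => e; rewrite -[RHS]e; apply: eq_bigr => k _.
  by rewrite compZ comp_nf0; congr (_ * _); apply: eq_nfval => i; case: (cp a b i).
have := congr1 (comp 1) (ev (fun i => D2_of (a i) (b i))).
rewrite comp_sum comp0 => e; rewrite -[RHS]e; apply: eq_bigr => k _.
by rewrite compZ comp_nf1; congr (_ * _); apply: eq_nfval => i; case: (cp a b i).
Qed.

End DiagonalComponents.

(** * Multilinear normal forms *)

Section Multilinear.
Variable n : nat.
Implicit Types (S : {set 'I_n}) (p : bool * {set 'I_n}).

Definition vals S : seq nat := [seq val i | i <- enum S].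

Lemma vals_uniq S : uniq (vals S).
Proof. by rewrite (map_inj_uniq val_inj) enum_uniq. Qed.

Lemma vals_sorted S : sorted leq (vals S).
Proof.
apply: (subseq_sorted leq_trans _ (iota_sorted 0 n)).
by rewrite -val_enum_ord map_subseq // {1}/enum_mem -enumT filter_subseq.
Qed.

Lemma vals_cover S : perm_eq (vals (~: S) ++ vals S) (iota 0 n).
Proof.
rewrite -val_enum_ord -map_cat perm_map //; apply: uniq_perm; rewrite ?enum_uniq //.
  rewrite cat_uniq !enum_uniq andbT /=; apply/hasPn => i.
  by rewrite !mem_enum inE negbK.
by move=> i; rewrite mem_cat !mem_enum !inE orNb.
Qed.

(** A multilinear normal form is determined by the set of letters inside the
    traces and by the number of traces. *)
Definition mlkey p : nfkey := (p.1, (vals (~: p.2), vals p.2)).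

Definition mlset : {set bool * {set 'I_n}} :=
  [set p : bool * {set 'I_n} | p.1 ==> (1 < #|p.2|)%N].

Lemma mlkey_inj : injective mlkey.
Proof.
move=> [b S] [b' S'] [-> _ e]; congr pair; apply/setP => i.
have memv (S0 : {set 'I_n}) : (val i \in vals S0) = (i \in S0).
  by rewrite (mem_map val_inj) mem_enum.
by rewrite -memv e memv.
Qed.

Lemma mlkey_word p : perm_eq (nfword (mlkey p)) (iota 0 n).
Proof. exact: vals_cover. Qed.

Lemma mlkey_wf p : p \in mlset -> nfwf (mlkey p).
Proof. by rewrite inE /nfwf /= !vals_sorted size_map cardE. Qed.

Lemma mlkey_onto k : nfwf k -> perm_eq (nfword k) (iota 0 n) ->
  exists2 p, p \in mlset & k = mlkey p.
Proof.
case: k => [b [u v]] /and3P [/= su sv bv]; rewrite /nfword /= => uvn.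
have uuv : uniq (u ++ v) by rewrite (perm_uniq uvn) iota_uniq.
have /and3P [uu huv uv] : [&& uniq u, ~~ has (mem u) v & uniq v] by rewrite -cat_uniq.
have mem_uv i : (i \in u ++ v) = (i < n)%N by rewrite (perm_mem uvn) mem_iota.
pose S := [set i : 'I_n | val i \in v].
have memS i : (i \in vals S) = (i \in v).
  apply/mapP/idP => [[j]|iv]; first by rewrite mem_enum inE => jv ->.
  have ilt : (i < n)%N by rewrite -mem_uv mem_cat iv orbT.
  by exists (Ordinal ilt); rewrite ?mem_enum ?inE.
have eqs w S' : sorted leq w -> uniq w -> vals S' =i w -> w = vals S'.
  move=> sw uw e; apply: (sorted_eq leq_trans anti_leq sw (vals_sorted S')).
  by apply: (uniq_perm uw (vals_uniq S')) => i; rewrite e.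
have vE : v = vals S by apply: eqs.
exists (b, S); first by rewrite inE /= cardE -(size_map val) -/(vals S) -vE.
congr (_, (_, _)) => //; apply: eqs => // i.
apply/mapP/idP => [[j]|iu].
  rewrite mem_enum !inE => jv ->; have := mem_uv j.
  by rewrite ltn_ord mem_cat (negPf jv) orbF.
have ilt : (i < n)%N by rewrite -mem_uv mem_cat iu.
exists (Ordinal ilt); rewrite ?mem_enum ?inE //=.
by apply: contra huv => iv; apply/hasP; exists i.
Qed.

(** The excluded pairs are (true, S) with S of size at most 1: n + 1 of the
    2 * 2^n pairs. *)
Lemma card_mlset : #|mlset| = (2 ^ n.+1 - n - 1)%N.
Proof.
have c1 : #|[set S : {set 'I_n} | (#|S| <= 1)%N]| = n.+1.
  have -> : [set S : {set 'I_n} | (#|S| <= 1)%N] = set0 |: [set [set i] | i in 'I_n].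
    apply/setP => S; rewrite !inE leq_eqVlt ltnS leqn0 cards_eq0 orbC.
    congr (_ || _); apply/cards1P/imsetP => [[i ->]|[i _ ->]]; by exists i.
  rewrite cardsU1 (card_imset _ set1_inj) card_ord.
  case: imsetP => [[i _ /esym/eqP]|//]; by rewrite -cards_eq0 cards1.
have cC : #|~: mlset| = n.+1.
  have -> : ~: mlset = setX [set true] [set S : {set 'I_n} | (#|S| <= 1)%N].
    by apply/setP => -[[] S]; rewrite !inE /= -?leqNgt.
  by rewrite cardsX cards1 mul1n.
have := cardsC mlset; rewrite cC card_prod card_bool.
have -> : #|{: {set 'I_n}}| = (2 ^ n)%N.
  by rewrite -cardsT -powersetT card_powerset cardsT card_ord.
by rewrite expnS; lia.
Qed.

End Multilinear.

(** * The identities of the diagonal matrices *)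

Section Main.
Variables (F : fieldType) (alpha beta : F).
Hypotheses (charF0 : [pchar F] =i pred0) (alpha_neq0 : alpha != 0)
  (beta_neq0 : beta != 0) (alpha_neq_beta : alpha != beta).

Let Id := Id_tr (t_trace alpha beta).

Lemma ideal_reduction (I P : {freetr F} -> Prop) d m : trace_T_ideal I ->
  I (f1 F) -> I (f4 alpha beta) -> I (f5 alpha beta) -> subspace P ->
  (forall f, I f -> P f) ->
  (forall k, nfwf k -> perm_eq (nfword k) d -> P (nff F k)) ->
  (forall i, occ i m = count_mem i d) -> P (mon F m).
Proof.
move=> tI If1 If4 If5 sP IP nfP om; rewrite mon_tev.
have rI := freetr_relation_ideal tI If1 If4 If5.
exact: (reduce_tev (central_trace_Tr F) rI alpha_neq0 beta_neq0 sP IP nfP om).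
Qed.

Lemma trace_T_ideal_subspace (I : {freetr F} -> Prop) : trace_T_ideal I -> subspace I.
Proof.
move=> tI; split=> [|c f g If Ig]; first exact: tT_zero.
apply: tT_add => //; rewrite -[f]mul1r -freetr_scalerAl; exact: tT_mull.
Qed.

Lemma Id_nff_free_malg (h : {malg F[nfkey]}) :
  (forall k, k \in msupp h -> nfwf k) -> Id (lext (@nff F) h) -> h = 0.
Proof.
move=> wh Idh; apply/malgP => k; rewrite mcoeff0; move: k.
apply: (Id_nff_free charF0 alpha_neq0 beta_neq0 alpha_neq_beta
  (fset_uniq (msupp h)) wh _ Idh).
by move=> k; apply: mcoeff_outdom.
Qed.

Definition generator (g : {freetr F}) : Prop :=
  [\/ g = f1 F, g = f4 alpha beta | g = f5 alpha beta].

Let J := generated_trace_T_ideal generator.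

Lemma trace_T_ideal_generated : trace_T_ideal J.
Proof.
split=> [I tI _|f g Jf Jg I tI gI|h f Jf I tI gI|h f Jf I tI gI|g f pg Jf I tI gI].
- exact: tT_zero.
- by apply: (tT_add tI); [apply: Jf | apply: Jg].
- by apply: (tT_mull tI); apply: Jf.
- by apply: (tT_mulr tI); apply: Jf.
- by apply: (tT_subst tI) => //; apply: Jf.
Qed.

Lemma generated_Id f : J f -> Id f.
Proof.
apply; first exact: trace_T_ideal_Id_tr.
by move=> g [] ->; [apply: Id_f1 | apply: Id_f4 | apply: Id_f5].
Qed.

(** Reduce f modulo J itself: the resulting combination of normal forms is an
    identity because J is contained in the identities, hence it is 0. *)
Lemma Id_generated f : Id f -> J f.
Proof.
move=> Idf; have tJ := trace_T_ideal_generated; have sJ := trace_T_ideal_subspace tJ.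
have gJ g : generator g -> J g by move=> gg I _; apply.
have [h [wh Jh]] : exists h : {malg F[nfkey]},
    (forall k, k \in msupp h -> nfwf k) /\ J (f - lext (@nff F) h).
  apply: (freetr_subspace (subspace_lext sJ (@nff F) nfwf)) => m _.
  have [d dm] : exists d, forall i, occ i m = count_mem i d.
    exists (flatten [seq val (repr c) | c <- cmseq m.1] ++ m.2) => i.
    by rewrite count_cat count_flatten -map_comp sumnE big_map /occ -sum_cmseq.
  apply: (ideal_reduction tJ (gJ _ (Or31 _ _ erefl)) (gJ _ (Or32 _ _ erefl))
    (gJ _ (Or33 _ _ erefl)) (subspace_lext sJ _ _) _ _ dm) => [g Jg|k wk _].
    by exists 0; split; [move=> k; rewrite msupp0 | rewrite linear0 subr0].
  exists << k >>; split; first by move=> k'; rewrite msuppU oner_eq0 inE => /eqP ->.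
  by rewrite lextU subrr; apply: sJ.1.
suff h0 : h = 0 by move: Jh; rewrite h0 linear0 subr0.
apply: Id_nff_free_malg => //; rewrite -[lext _ _](subKr f).
apply: (subspaceB (trace_T_ideal_subspace (trace_T_ideal_Id_tr _))) => //.
exact: generated_Id.
Qed.

Lemma MT_subspace n : subspace (@MT F n).
Proof.
split=> [m|c f g Mf Mg m]; first by rewrite msupp0.
move/(fsubsetP (msuppD_le _ _)); rewrite inE => /orP [|/Mg //].
by move/(fsubsetP (msuppZ_le _ _))/Mf.
Qed.

Lemma MT_nff n k : nfwf k -> perm_eq (nfword k) (iota 0 n) -> MT n (nff F k).
Proof.
move=> wk kn m; have [m' [-> om]] := nff_mon F wk.
rewrite msupp_mon => /eqP -> i; rewrite om (permP kn).
by rewrite count_uniq_mem ?iota_uniq // mem_iota.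
Qed.

(** Here the reduction is applied modulo the ideal of identities; it preserves
    the multidegree, so it stays among the multilinear normal forms. *)
Lemma trace_codim_D2 n : trace_codim (t_trace alpha beta) n (2 ^ n.+1 - n - 1)%N.
Proof.
rewrite -card_mlset; pose key (i : 'I_#|mlset n|) := mlkey (enum_val i).
have key_wf i : nfwf (key i) by apply: mlkey_wf; apply: enum_valP.
have key_inj : injective key by move=> i j /mlkey_inj /enum_val_inj.
have key_word i : perm_eq (nfword (key i)) (iota 0 n) by apply: mlkey_word.
have tId := trace_T_ideal_Id_tr (t_trace alpha beta).
have sId := trace_T_ideal_subspace tId.
exists (fun i => nff F (key i)); split=> [i|c [_ Idc] i|u Mu].
- by apply: MT_nff.
- pose c' k := \sum_j c j * (key j == k)%:R.
  have c'E j : c' (key j) = c j.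
    rewrite /c' (bigD1 j) //= eqxx mulr1 big1 ?addr0 // => l lj.
    by rewrite (inj_eq key_inj) (negPf lj) mulr0.
  rewrite -c'E; pose ks := [seq key j | j <- index_enum 'I_#|mlset n|].
  apply: (Id_nff_free charF0 alpha_neq0 beta_neq0 alpha_neq_beta (ks := ks)).
  + by rewrite map_inj_uniq // index_enum_uniq.
  + by move=> k /mapP [j _ ->].
  + move=> k kks; rewrite /c' big1 // => j _; case: eqP => [e|]; last by rewrite mulr0.
    by case/negP: kks; rewrite -e map_f ?mem_index_enum.
  + by rewrite /ks big_map; under eq_bigr do rewrite c'E.
have [c Idc] : exists c : 'I_#|mlset n| -> F, Id (u - \sum_i c i *: nff F (key i)).
  have sP := subspace_comb sId (fun i => nff F (key i)).
  apply: (freetr_subspace sP) => m /Mu om.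
  apply: (ideal_reduction (d := iota 0 n) tId (@Id_f1 _ _ _) (@Id_f4 _ _ _) (@Id_f5 _ _ _) sP).
  + move=> f Idf; exists (fun=> 0); rewrite big1 ?subr0 // => i _; exact: scale0r.
  + move=> k wk /(mlkey_onto wk) [p pA ->]; pose i := enum_rank_in pA p.
    have ki : key i = mlkey p by rewrite /key /i enum_rankK_in.
    rewrite -ki; exists (fun j => (j == i)%:R).
    rewrite (bigD1 i) //= eqxx scale1r big1 ?addr0.
      by rewrite subrr; apply: sId.1.
    by move=> j /negPf ->; apply: scale0r.
  + by move=> i; rewrite om count_uniq_mem ?iota_uniq // mem_iota.
exists c; split=> //; apply: (subspaceB (MT_subspace n)) => //.
apply: (subspace_sum (MT_subspace n)) => i _.
by apply: (subspaceZ (MT_subspace n)); apply: MT_nff.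
Qed.

End Main.

Theorem theorem11 (F : fieldType) (charF0 : [pchar F] =i pred0)
    (alpha beta : F) (alpha_neq0 : alpha != 0) (beta_neq0 : beta != 0)
    (alpha_neq_beta : alpha != beta) :
  (forall f : {freetr F},
     Id_tr (t_trace alpha beta) f <->
     generated_trace_T_ideal
       (fun g => [\/ g = f1 F, g = f4 alpha beta | g = f5 alpha beta]) f)
  /\ (forall n : nat, (1 <= n)%N ->
        trace_codim (t_trace alpha beta) n (2 ^ n.+1 - n - 1)%N).
Proof.
split=> [f|n _]; last exact: trace_codim_D2.
by split; [apply: Id_generated | apply: generated_Id].
Qed.
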